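(* Let $A$ be a connection on the trivial bundle and $\phi=\sum_{i=1}^4\phi_i\,dx^i$ a $\mathfrak g$-valued $1$-form on the half-space $\mathbb R^4_+=\{x\in\mathbb R^4: x^4\ge0\}$ with the Euclidean metric, both smooth, and such that the integrals below converge. Then $$-\int_{\mathbb R^4_+}d^4x\,\mathrm{Tr}\Big(\tfrac12\sum_{i,j=1}^4\mathcal V_{ij}\mathcal V_{ij}+(\mathcal V^0)^2\Big)=I''+\Omega_1+\Omega_2+\Omega_3,$$ where $$I''=-\int_{\mathbb R^4_+}d^4x\,\mathrm{Tr}\Big(\mathcal X\overline{\mathcal X}+\mathcal Y\overline{\mathcal Y}+\mathcal Z\overline{\mathcal Z}+\mu^2+\sum_{a=1}^4\big(F_{1a}^2+(D_1\phi_a)^2+[\phi_a,\phi_4]^2\big)+\sum_{b=2}^4(D_b\phi_4)^2\Big),$$ $$\Omega_1=-2\int_{\mathbb R^4_+}d^4x\Big(\sum_{a=1}^3\big(\partial_a\mathrm{Tr}\,\phi_aD_4\phi_4-\partial_4\mathrm{Tr}\,\phi_aD_a\phi_4\big)+\sum_{a=2}^3\big(\partial_1\mathrm{Tr}\,\phi_1D_a\phi_a-\partial_a\mathrm{Tr}\,\phi_1D_1\phi_a\big)\Big),$$ $$\Omega_2=-2\int_{\mathbb R^4_+}d^4x\Big(-\partial_1\mathrm{Tr}\,\phi_2[\phi_3,\phi_4]+\partial_2\mathrm{Tr}\,\phi_3[\phi_4,\phi_1]-\partial_3\mathrm{Tr}\,\phi_4[\phi_1,\phi_2]\Big),$$ $$\Omega_3=-2\int_{\mathbb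 R^4_+}d^4x\Big(\partial_1\mathrm{Tr}(\phi_2F_{34}+\phi_3F_{42}+\phi_4F_{23})+\partial_2\mathrm{Tr}(-\phi_3F_{41}-\phi_4F_{13})+\partial_3\mathrm{Tr}(\phi_2F_{41}+\phi_4F_{12})+\partial_4\mathrm{Tr}(-\phi_3F_{12}+\phi_2F_{13})\Big).$$
   Context: $\mathfrak g=\mathfrak{su}(2)$ (traceless antihermitian $2\times2$ matrices) and $\mathrm{Tr}$ is the matrix trace (so $-\mathrm{Tr}$ is positive definite on $\mathfrak g$). $D_i=\partial_i+[A_i,\cdot\,]$, $F_{ij}=\partial_iA_j-\partial_jA_i+[A_i,A_j]$, $\epsilon_{1234}=1$, and $$\mathcal V_{ij}=F_{ij}-[\phi_i,\phi_j]+\sum_{k,l}\epsilon_{ijkl}D_k\phi_l,\qquad\mathcal V^0=\sum_{i=1}^4D_i\phi_i,$$ so that $\mathcal V_{ij}=\mathcal V^0=0$ are the Kapustin–Witten (KW) equations. Further $$\mathcal D_1=D_2+iD_3,\quad\mathcal D_2=D_4-i[\phi_1,\cdot\,],\quad\mathcal D_3=[\phi_2-i\phi_3,\cdot\,],$$ $$\mathcal X=[\mathcal D_1,\mathcal D_2],\quad\mathcal Y=[\mathcal D_2,\mathcal D_3],\quad\mathcal Z=[\mathcal D_3,\mathcal D_1],\quad\mu=F_{23}-[\phi_2,\phi_3]-D_4\phi_1,$$ where the commutators $\mathcal X,\mathcal Y,\mathcal Z$ are identified with $\mathfrak g\otimes\mathbb C$-valued functions acting by the adjoint action, and $\overline{\,\cdot\,}$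 denotes complex conjugation of $\mathfrak g\otimes\mathbb C$ with respect to the real form $\mathfrak g$. For matrix-valued quantities, $\partial_i\mathrm{Tr}\,PQ$ means $\partial_i(\mathrm{Tr}(PQ))$. *)

(* Defs.v *)
From HB Require Import structures.
From mathcomp Require Import all_boot all_order all_algebra.
From mathcomp Require Import complex ring.
From mathcomp Require Import all_classical all_reals all_analysis.
Import Order.TTheory GRing.Theory Num.Theory.
Import numFieldNormedType.Exports.
Set Implicit Arguments.
Unset Strict Implicit.
Unset Printing Implicit Defensive.
Local Open Scope classical_set_scope.
Local Open Scope ring_scope.

Definition i1 : 'I_4 := @Ordinal 4 0 isT.
Definition i2 : 'I_4 := @Ordinal 4 1 isT.
Definition i3 : 'I_4 := @Ordinal 4 2 isT.
Definition i4 : 'I_4 := @Ordinal 4 3 isT.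

Definition halfspace (R : realType) : set 'rV[R]_4 :=
  [set x : 'rV[R]_4 | 0 <= x ord0 i4].
Arguments halfspace R : clear implicits.

(* The limit only involves points of the half-space: on the boundary, the
   derivative along [i4] is the one-sided one.  Hence nothing below depends on
   the values of the fields outside the half-space. *)
Definition partialR (R : realType) (i : 'I_4) (f : 'rV[R]_4 -> R)
    (x : 'rV[R]_4) : R :=
  lim ((fun h : R => h^-1 * (f (x + h *: delta_mx ord0 i) - f x))
         @ within [set h : R | halfspace R (x + h *: delta_mx ord0 i)] 0^').

Definition partialC (R : realType) (i : 'I_4) (f : 'rV[R]_4 -> R[i])
    (x : 'rV[R]_4) : R[i] :=
  (partialR i (fun y => complex.Re (f y)) x
     +i* partialR i (fun y => complex.Im (f y)) x)%C.

Definition partial (R : realType) (i : 'I_4) (s : 'rV[R]_4 -> 'M[R[i]]_2)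
    (x : 'rV[R]_4) : 'M[R[i]]_2 :=
  \matrix_(k, l) partialC i (fun y => s y k l) x.

Fixpoint Ck (R : realType) (k : nat) (f : 'rV[R]_4 -> R) : Prop :=
  continuous f /\
  if k is k'.+1 then
    forall i : 'I_4, (forall x, derivable f x (delta_mx ord0 i)) /\
                     Ck k' (fun x => 'D_(delta_mx ord0 i) f x)
  else True.

(* Smoothness up to the boundary: by Seeley's theorem, the existence of a global
   smooth extension is equivalent to the existence of local ones. *)
Definition smooth_on_half (R : realType) (f : 'rV[R]_4 -> R) : Prop :=
  exists g : 'rV[R]_4 -> R,
    (forall k : nat, Ck k g) /\ (forall x, halfspace R x -> f x = g x).

Definition smooth_field (R : realType) (s : 'rV[R]_4 -> 'M[R[i]]_2) : Prop :=
  forall k l : 'I_2,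
    smooth_on_half (fun x => complex.Re (s x k l)) /\
    smooth_on_half (fun x => complex.Im (s x k l)).

Definition adjoint (R : realType) (M : 'M[R[i]]_2) : 'M[R[i]]_2 :=
  (map_mx conjc M)^T.

Definition su2 (R : realType) (M : 'M[R[i]]_2) : Prop :=
  adjoint M = - M /\ \tr M = 0.

(* su(2) tensored with C, as a subspace of the 2 x 2 complex matrices. *)
Definition sl2 (R : realType) (M : 'M[R[i]]_2) : Prop := \tr M = 0.

(* The conjugation of sl(2, C) with respect to its real form su(2); see
   [conj_suE]. *)
Definition conj_su (R : realType) (M : 'M[R[i]]_2) : 'M[R[i]]_2 :=
  - adjoint M.

Lemma conj_suE (R : realType) (P Q : 'M[R[i]]_2) :
  su2 P -> su2 Q -> conj_su (P + 'i%C *: Q) = P - 'i%C *: Q.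
Proof.
move=> [/matrixP hP _] [/matrixP hQ _]; apply/matrixP => k l.
move: (hP k l) (hQ k l); rewrite !mxE.
case: (P l k) (P k l) (Q l k) (Q k l) => [a b] [c d] [a' b'] [c' d'].
by case=> -> /eqP; rewrite eqr_opp => /eqP ->; case=> -> /eqP;
  rewrite eqr_opp => /eqP ->; apply/eqP; rewrite eq_complex /=;
  apply/andP; split; apply/eqP; ring.
Qed.

Definition lie (R : realType) (P Q : 'M[R[i]]_2) : 'M[R[i]]_2 :=
  P *m Q - Q *m P.

Definition tr2 (R : realType) (P Q : 'M[R[i]]_2) : R[i] := \tr (P *m Q).

Definition levi_civita (i j k l : 'I_4) : int :=
  let s (a b : 'I_4) : int := Num.sg ((b : nat)%:Z - (a : nat)%:Z) in
  s i j * s i k * s i l * s j k * s j l * s k l.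

(* A connection on the trivial bundle, or a 1-form, with values in su(2). *)
Definition su2_form (R : realType)
    (A : 'I_4 -> 'rV[R]_4 -> 'M[R[i]]_2) : Prop :=
  forall i : 'I_4,
    smooth_field (A i) /\ (forall x, halfspace R x -> su2 (A i x)).

Definition D (R : realType) (A : 'I_4 -> 'rV[R]_4 -> 'M[R[i]]_2) (i : 'I_4)
    (s : 'rV[R]_4 -> 'M[R[i]]_2) (x : 'rV[R]_4) : 'M[R[i]]_2 :=
  partial i s x + lie (A i x) (s x).

Definition F (R : realType) (A : 'I_4 -> 'rV[R]_4 -> 'M[R[i]]_2) (i j : 'I_4)
    (x : 'rV[R]_4) : 'M[R[i]]_2 :=
  partial i (A j) x - partial j (A i) x + lie (A i x) (A j x).

Definition KW (R : realType) (A phi : 'I_4 -> 'rV[R]_4 -> 'M[R[i]]_2)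
    (i j : 'I_4) (x : 'rV[R]_4) : 'M[R[i]]_2 :=
  F A i j x - lie (phi i x) (phi j x)
  + \sum_(k < 4) \sum_(l < 4) D A k (phi l) x *~ levi_civita i j k l.

Definition KW0 (R : realType) (A phi : 'I_4 -> 'rV[R]_4 -> 'M[R[i]]_2)
    (x : 'rV[R]_4) : 'M[R[i]]_2 :=
  \sum_(i < 4) D A i (phi i) x.

Definition cD1 (R : realType) (A phi : 'I_4 -> 'rV[R]_4 -> 'M[R[i]]_2)
    (s : 'rV[R]_4 -> 'M[R[i]]_2) (x : 'rV[R]_4) : 'M[R[i]]_2 :=
  D A i2 s x + 'i%C *: D A i3 s x.

Definition cD2 (R : realType) (A phi : 'I_4 -> 'rV[R]_4 -> 'M[R[i]]_2)
    (s : 'rV[R]_4 -> 'M[R[i]]_2) (x : 'rV[R]_4) : 'M[R[i]]_2 :=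
  D A i4 s x - 'i%C *: lie (phi i1 x) (s x).

Definition cD3 (R : realType) (A phi : 'I_4 -> 'rV[R]_4 -> 'M[R[i]]_2)
    (s : 'rV[R]_4 -> 'M[R[i]]_2) (x : 'rV[R]_4) : 'M[R[i]]_2 :=
  lie (phi i2 x - 'i%C *: phi i3 x) (s x).

(* The value at [x] of the commutator [[S, T]], identified with an
   sl(2, C)-valued function: the M in sl(2, C) such that
   [S (T s) - T (S s)] takes the value [lie M (s x)] at [x] for every smooth
   sl(2, C)-valued [s].  Such an M is unique since the centre of sl(2, C) is
   trivial. *)
Definition opcomm (R : realType)
    (S T : ('rV[R]_4 -> 'M[R[i]]_2) -> 'rV[R]_4 -> 'M[R[i]]_2)
    (x : 'rV[R]_4) : 'M[R[i]]_2 :=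
  xget 0 [set M : 'M[R[i]]_2 | sl2 M /\
    forall s : 'rV[R]_4 -> 'M[R[i]]_2,
      smooth_field s -> (forall y, halfspace R y -> sl2 (s y)) ->
      S (T s) x - T (S s) x = lie M (s x)].

Definition calX (R : realType) (A phi : 'I_4 -> 'rV[R]_4 -> 'M[R[i]]_2) :=
  opcomm (cD1 A phi) (cD2 A phi).
Definition calY (R : realType) (A phi : 'I_4 -> 'rV[R]_4 -> 'M[R[i]]_2) :=
  opcomm (cD2 A phi) (cD3 A phi).
Definition calZ (R : realType) (A phi : 'I_4 -> 'rV[R]_4 -> 'M[R[i]]_2) :=
  opcomm (cD3 A phi) (cD1 A phi).

Definition mu (R : realType) (A phi : 'I_4 -> 'rV[R]_4 -> 'M[R[i]]_2)
    (x : 'rV[R]_4) : 'M[R[i]]_2 :=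
  F A i2 i3 x - lie (phi i2 x) (phi i3 x) - D A i4 (phi i1) x.

(* The Lebesgue measure on R^4, as a fourfold product. *)
Definition leb4 (R : realType) :=
  (((@lebesgue_measure R \x @lebesgue_measure R) \x @lebesgue_measure R)
     \x @lebesgue_measure R)%E.
Arguments leb4 R : clear implicits.

Definition pt (R : realType) (p : R * R * R * R) : 'rV[R]_4 :=
  \row_(i < 4) tnth [tuple p.1.1.1; p.1.1.2; p.1.2; p.2] i.

Definition converges (R : realType) (f : 'rV[R]_4 -> R[i]) : Prop :=
  (leb4 R).-integrable (@pt R @^-1` halfspace R)
    (fun p => (complex.Re (f (pt p)))%:E) /\
  (leb4 R).-integrable (@pt R @^-1` halfspace R)
    (fun p => (complex.Im (f (pt p)))%:E).

Definition int4 (R : realType) (f : 'rV[R]_4 -> R[i]) : R[i] :=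
  (Rintegral (leb4 R) (@pt R @^-1` halfspace R)
     (fun p => complex.Re (f (pt p)))
   +i* Rintegral (leb4 R) (@pt R @^-1` halfspace R)
     (fun p => complex.Im (f (pt p))))%C.

Definition KW_density (R : realType)
    (A phi : 'I_4 -> 'rV[R]_4 -> 'M[R[i]]_2) (x : 'rV[R]_4) : R[i] :=
  \tr (2^-1 *: (\sum_(i < 4) \sum_(j < 4) KW A phi i j x *m KW A phi i j x)
       + KW0 A phi x *m KW0 A phi x).

Definition I_density (R : realType)
    (A phi : 'I_4 -> 'rV[R]_4 -> 'M[R[i]]_2) (x : 'rV[R]_4) : R[i] :=
  \tr (calX A phi x *m conj_su (calX A phi x)
       + calY A phi x *m conj_su (calY A phi x)
       + calZ A phi x *m conj_su (calZ A phi x)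
       + mu A phi x *m mu A phi x
       + \sum_(a < 4) (F A i1 a x *m F A i1 a x
                       + D A i1 (phi a) x *m D A i1 (phi a) x
                       + lie (phi a x) (phi i4 x) *m lie (phi a x) (phi i4 x))
       + \sum_(b <- [:: i2; i3; i4]) D A b (phi i4) x *m D A b (phi i4) x).

Definition Omega1_density (R : realType)
    (A phi : 'I_4 -> 'rV[R]_4 -> 'M[R[i]]_2) (x : 'rV[R]_4) : R[i] :=
  \sum_(a <- [:: i1; i2; i3])
     (partialC a (fun y => tr2 (phi a y) (D A i4 (phi i4) y)) x
      - partialC i4 (fun y => tr2 (phi a y) (D A a (phi i4) y)) x)
  + \sum_(a <- [:: i2; i3])
     (partialC i1 (fun y => tr2 (phi i1 y) (D A a (phi a) y)) x
      - partialC a (fun y => tr2 (phi i1 y) (D A i1 (phi a) y)) x).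

Definition Omega2_density (R : realType)
    (phi : 'I_4 -> 'rV[R]_4 -> 'M[R[i]]_2) (x : 'rV[R]_4) : R[i] :=
  - partialC i1 (fun y => tr2 (phi i2 y) (lie (phi i3 y) (phi i4 y))) x
  + partialC i2 (fun y => tr2 (phi i3 y) (lie (phi i4 y) (phi i1 y))) x
  - partialC i3 (fun y => tr2 (phi i4 y) (lie (phi i1 y) (phi i2 y))) x.

Definition Omega3_density (R : realType)
    (A phi : 'I_4 -> 'rV[R]_4 -> 'M[R[i]]_2) (x : 'rV[R]_4) : R[i] :=
  partialC i1 (fun y => \tr (phi i2 y *m F A i3 i4 y + phi i3 y *m F A i4 i2 y
                             + phi i4 y *m F A i2 i3 y)) x
  + partialC i2 (fun y => \tr (- (phi i3 y *m F A i4 i1 y)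
                               - phi i4 y *m F A i1 i3 y)) x
  + partialC i3 (fun y => \tr (phi i2 y *m F A i4 i1 y
                               + phi i4 y *m F A i1 i2 y)) x
  + partialC i4 (fun y => \tr (- (phi i3 y *m F A i1 i2 y)
                               + phi i2 y *m F A i1 i3 y)) x.

Definition Ipp (R : realType) (A phi : 'I_4 -> 'rV[R]_4 -> 'M[R[i]]_2) : R[i] :=
  - int4 (I_density A phi).
Definition Omega1 (R : realType)
    (A phi : 'I_4 -> 'rV[R]_4 -> 'M[R[i]]_2) : R[i] :=
  - 2 * int4 (Omega1_density A phi).
Definition Omega2 (R : realType)
    (phi : 'I_4 -> 'rV[R]_4 -> 'M[R[i]]_2) : R[i] :=
  - 2 * int4 (Omega2_density phi).
Definition Omega3 (R : realType)
    (A phi : 'I_4 -> 'rV[R]_4 -> 'M[R[i]]_2) : R[i] :=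
  - 2 * int4 (Omega3_density A phi).

(* Main.v *)
Require Import Defs.
From HB Require Import structures.
From mathcomp Require Import all_boot all_order all_algebra.
From mathcomp Require Import complex ring.
From mathcomp Require Import all_classical all_reals all_analysis.
Import Order.TTheory GRing.Theory Num.Theory.
Import numFieldNormedType.Exports.
Local Open Scope ring_scope.
Set Implicit Arguments.
Unset Strict Implicit.
Unset Printing Implicit Defensive.

(** The identity holds pointwise: on the half-space the Kapustin-Witten density
    equals the density of I'' plus twice the sum of the three divergence
    densities [KW_densityE], and the theorem follows by linearity of the
    integral.

    Fix a point and write F for the curvatures, G_ab = D_a phi_b and
    L_ab = [phi_a, phi_b].  The left-hand side is by definition a quadratic form
    in F, G, L for the pairing tr2 P Q = Tr (P Q).  Everything on the right-hand
    side can be brought to the same form.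
    - The operator commutators are X = (F_24 + G_31) + i (F_34 - G_21) and
      similarly for Y and Z [calXE], [calYE], [calZE]; since F, G, L take values
      in su(2), Tr (X conj X) is the sum of the squares of the two parts
      [tr_conj_su].
    - In the three divergence densities all second derivatives disappear.  In
      the first one they occur antisymmetrized, hence as curvature
      [divergence_pair]; the second one has none, and the invariance of the
      trace form makes Tr (P [Q, S]) cyclic [divergence_triple]; in the third
      one they are covariant derivatives of the curvature, which add up to three
      instances of the Bianchi identity [Omega3_densityE].
    What is left is a polynomial identity between quadratic forms in independent
    antisymmetric families F, L and an arbitrary family G [energy_identity].

    The analytic content is that the partial derivatives on the closed
    half-space, one-sided on the boundary, are restrictions of the derivatives
    of any smooth extension [partialR_derive].  They therefore obey the Leibniz
    rule and commute with each other, boundary included, and these two facts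
    give the covariant calculus: [D_lie], [D_comm] and [bianchi]. *)

(** * Symmetry of mixed partial derivatives *)

Section MixedPartials.
Local Open Scope classical_set_scope.
Local Open Scope ring_scope.
Variables (R : realType) (V : normedModType R).
Implicit Types (f : V -> R) (x u v : V).

Lemma is_derive_line f x u t :
  derivable f (x + t *: u) u ->
  is_derive t 1 (fun s : R => f (x + s *: u)) ('D_u f (x + t *: u)).
Proof.
move=> df.
have E : (fun h : R => h^-1 *: (((fun s : R => f (x + s *: u)) \o shift t)
            (h *: 1) - f (x + t *: u))) =
         (fun h : R => h^-1 *: ((f \o shift (x + t *: u)) (h *: u)
            - f (x + t *: u))).
  apply/funext => h /=; rewrite [h *: 1]mulr1 scalerDl.
  by rewrite addrCA.
by split; rewrite /derivable /derive E.
Qed.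

(** The mean value theorem applied twice, first to the increment in the direction
    v as a function along u, then along v.  The left-hand side is symmetric under
    exchanging u and v, which is how [derive_comm] uses it. *)
Lemma second_difference f x u v (h : R) : 0 < h ->
  (forall y, derivable f y u) -> (forall y, derivable ('D_u f) y v) ->
  exists s t, [/\ 0 < s < h, 0 < t < h &
    f (x + h *: u + h *: v) - f (x + h *: u) - f (x + h *: v) + f x =
    'D_v ('D_u f) (x + s *: u + t *: v) * h * h].
Proof.
move=> h0 du dv.
pose g (s : R) := f (x + h *: v + s *: u) - f (x + s *: u).
have dg (s : R) : is_derive s 1 g
    ('D_u f (x + h *: v + s *: u) - 'D_u f (x + s *: u)).
  by apply: is_deriveB; exact: is_derive_line.
have cont (k : R -> R) : (forall s, derivable k s 1) ->
    {within `[0, h], continuous k}.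
  move=> dk; apply: continuous_subspaceT => s.
  exact/differentiable_continuous/derivable1_diffP.
have [s] := MVT h0 (fun s _ => dg s) (cont g (fun s => ex_derive (is_derive := dg s))).
rewrite in_itv /= => s_h.
pose k (t : R) := 'D_u f (x + s *: u + t *: v).
have dk (t : R) : is_derive t 1 k ('D_v ('D_u f) (x + s *: u + t *: v)).
  exact: is_derive_line.
have [t] := MVT h0 (fun t _ => dk t) (cont k (fun t => ex_derive (is_derive := dk t))).
rewrite in_itv /= => t_h; rewrite /k /g !scale0r !addr0 !subr0 => Ek Eg.
exists s, t; split => //.
rewrite -Ek (addrAC x (s *: u)) -Eg (addrAC x (h *: u)).
by rewrite opprB [RHS]addrA [RHS]addrAC.
Qed.

Lemma dist_halves (a b c e : R) :
  `|a - c| < e / 2 -> `|b - c| < e / 2 -> `|b - a| <= e.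
Proof.
move=> ac bc; apply: ltW; apply: le_lt_trans (ler_distD c b a) _.
by rewrite [e]splitr ltrD// distrC.
Qed.

(** The second difference at scale h is h^2 times either mixed derivative at some
    point near x; let h tend to 0 and use continuity. *)
Lemma derive_comm f u v :
  (forall y, derivable f y u) -> (forall y, derivable f y v) ->
  (forall y, derivable ('D_u f) y v) -> (forall y, derivable ('D_v f) y u) ->
  continuous ('D_v ('D_u f)) -> continuous ('D_u ('D_v f)) ->
  'D_u ('D_v f) = 'D_v ('D_u f).
Proof.
move=> du dv duv dvu cuv cvu; apply/funext => x.
apply/eqP; rewrite -subr_eq0 -normr_le0; apply/ler_addgt0Pr => e e0; rewrite add0r.
have e20 : 0 < e / 2 by rewrite divr_gt0.
have /cvgrPdist_lt/(_ _ e20)/nbhs_ballP[d1 /= d10 B1] := cuv x.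
have /cvgrPdist_lt/(_ _ e20)/nbhs_ballP[d2 /= d20 B2] := cvu x.
have [d [d0 dd1 dd2]] : exists d, [/\ 0 < d, d <= d1 & d <= d2].
  by exists (Num.min d1 d2); rewrite lt_min d10 d20 !ge_min !lexx orbT.
(* The summand 1 keeps m positive when u and v both vanish. *)
have [m mE] : exists m, `|u| + `|v| + 1 = m by eexists.
have mE' : `|v| + `|u| + 1 = m by rewrite -mE (addrC `|v|).
have m0 : 0 < m by rewrite -mE ltr_wpDl// addr_ge0.
have h0 : 0 < d / m by rewrite divr_gt0.
have [s [t [sh th E1]]] := second_difference x h0 du duv.
have [t' [s' [t'h s'h E2]]] := second_difference x h0 dv dvu.
have near_x (p q : R) (u' v' : V) : `|u'| + `|v'| + 1 = m ->
    0 < p < d / m -> 0 < q < d / m -> `|x - (x + p *: u' + q *: v')| < d.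
  move=> m'E /andP[p0 ph] /andP[q0 qh].
  rewrite -addrA opprD addNKr normrN.
  apply: le_lt_trans (ler_normD _ _) _; rewrite !normrZ !gtr0_norm//.
  have le1 : p * `|u'| <= d / m * `|u'| by rewrite ler_wpM2r// ltW.
  have le2 : q * `|v'| <= d / m * `|v'| by rewrite ler_wpM2r// ltW.
  apply: le_lt_trans (lerD le1 le2) _.
  by rewrite -mulrDr mulrAC ltr_pdivrMr// ltr_pM2l// -m'E ltrDl.
have EE : 'D_v ('D_u f) (x + s *: u + t *: v) =
          'D_u ('D_v f) (x + t' *: v + s' *: u).
  have hn : d / m != 0 by rewrite gt_eqF.
  apply: (mulIf hn); apply: (mulIf hn).
  refine (etrans (esym E1) (etrans _ E2)).
  by rewrite [x + _ + _]addrAC; congr (_ + _); exact: addrAC.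
have b1 : `|'D_v ('D_u f) x - 'D_v ('D_u f) (x + s *: u + t *: v)| < e / 2.
  have st : `|x - (x + s *: u + t *: v)| < d.
    exact: near_x mE sh th.
  by apply: B1; rewrite -ball_normE; exact: (lt_le_trans st dd1).
have b2 : `|'D_u ('D_v f) x - 'D_u ('D_v f) (x + t' *: v + s' *: u)| < e / 2.
  have ts : `|x - (x + t' *: v + s' *: u)| < d.
    exact: near_x mE' t'h s'h.
  by apply: B2; rewrite -ball_normE; exact: (lt_le_trans ts dd2).
rewrite -EE in b2.
exact: dist_halves b1 b2.
Qed.

End MixedPartials.

(** * Smooth functions and partial derivatives on the half-space *)

Section SmoothOnHalf.
Local Open Scope classical_set_scope.
Local Open Scope ring_scope.
Variable R : realType.
Implicit Types (f g : 'rV[R]_4 -> R) (x : 'rV[R]_4) (i j : 'I_4) (k : nat).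

Notation e i := (delta_mx ord0 i : 'rV[R]_4).

Lemma Ck_continuous k f : Ck k f -> continuous f.
Proof. by case: k => [|k] []. Qed.

Lemma CkW k f : Ck k.+1 f -> Ck k f.
Proof.
elim: k f => [|k IH] f [cf df]; first by split.
split=> // i.
by have [dfi Cfi] := df i; split; [exact: dfi|exact: IH].
Qed.

Lemma Ck_cst k (c : R) : Ck k (fun _ => c).
Proof.
have cc c' : continuous (fun _ : 'rV[R]_4 => c' : R).
  exact: cst_continuous.
elim: k c => [|k IH] c; first exact: (conj (cc c) I).
split; [exact: cc | move=> i; split].
  by move=> x; exact: (derivable_cst (_ : R)).
rewrite [X in Ck _ X](_ : _ = (fun _ => 0)); first exact: IH.
by apply/funext => x; exact: derive_cst.
Qed.

Lemma Ck_add k f g : Ck k f -> Ck k g -> Ck k (fun x => f x + g x).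
Proof.
elim: k f g => [|k IH] f g [cf df] [cg dg]; split => //;
  try by move=> x; exact: (cvgD (cf x) (cg x)).
move=> i; have [dfi Cfi] := df i; have [dgi Cgi] := dg i.
split; first by move=> x; exact: derivableD.
rewrite [X in Ck _ X](_ : _ = (fun x => 'D_(e i) f x + 'D_(e i) g x)).
  exact: IH.
by apply/funext => x; exact: deriveD.
Qed.

Lemma Ck_mul k f g : Ck k f -> Ck k g -> Ck k (fun x => f x * g x).
Proof.
elim: k f g => [|k IH] f g Cf Cg.
  by case: Cf Cg => [cf _] [cg _]; split => // x; exact: (cvgM (cf x) (cg x)).
have [[cf df] [cg dg]] := (Cf, Cg).
split; first by move=> x; exact: (cvgM (cf x) (cg x)).
move=> i; have [dfi Cfi] := df i; have [dgi Cgi] := dg i.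
split; first by move=> x; exact: derivableM.
rewrite [X in Ck _ X](_ : _ =
  (fun x => f x * 'D_(e i) g x + g x * 'D_(e i) f x)).
  by apply: Ck_add; apply: IH => //; exact: CkW.
by apply/funext => x; exact: deriveM.
Qed.

Definition smooth f := forall k, Ck k f.

Lemma smooth_derivable x i f : smooth f -> derivable f x (e i).
Proof. by move=> /(_ 1%N) [_ /(_ i) []]. Qed.

Lemma smooth_derive f i : smooth f -> smooth ('D_(e i) f).
Proof. by move=> Cf k; have [_ /(_ i) []] := Cf k.+1. Qed.

Lemma smooth_derive_comm f i j : smooth f ->
  'D_(e i) ('D_(e j) f) = 'D_(e j) ('D_(e i) f).
Proof.
move=> Cf; have Di := smooth_derive i Cf; have Dj := smooth_derive j Cf.
apply: derive_comm.
- by move=> y; exact: smooth_derivable Cf.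
- by move=> y; exact: smooth_derivable Cf.
- by move=> y; exact: smooth_derivable Di.
- by move=> y; exact: smooth_derivable Dj.
- exact: (Ck_continuous (smooth_derive j Di 0%N)).
- exact: (Ck_continuous (smooth_derive i Dj 0%N)).
Qed.

Lemma halfspace_shift x i (h : R) : halfspace R x -> 0 < h ->
  halfspace R (x + h *: e i).
Proof.
move=> x0 h0; rewrite /halfspace /= !mxE addr_ge0// mulr_ge0 ?ler0n//.
exact: ltW.
Qed.

(** The difference quotients of f and of its extension g coincide along the
    increments that stay in the half-space, and 0 is a limit point of those, so
    the restricted limit for f is the full limit for g. *)
Lemma partialR_derive f g x i : smooth g ->
  (forall y, halfspace R y -> f y = g y) -> halfspace R x ->
  partialR i f x = 'D_(e i) g x.
Proof.
move=> Cg fg Hx.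
set S := [set h : R | halfspace R (x + h *: e i)].
have FF : ProperFilter (within S 0^').
  apply: Build_ProperFilter_ex => P; rewrite /within /= => /nbhs_ballP [r /= r0 Pr].
  have r2 : 0 < r / 2 by rewrite divr_gt0.
  exists (r / 2); apply: (Pr (r / 2)).
  - rewrite /ball /= sub0r normrN gtr0_norm//.
    by rewrite ltr_pdivrMr// mulr_natr mulr2n ltrDl.
  - by rewrite gt_eqF.
  - exact: halfspace_shift.
pose q (h : R) := h^-1 *: ((g \o shift x) (h *: e i) - g x).
have qD : q @ 0^' --> 'D_(e i) g x := smooth_derivable Cg.
have qW : q @ within S 0^' --> 'D_(e i) g x by exact: cvg_within_filter.
apply: cvg_lim; first exact: norm_hausdorff.
refine (cvg_trans _ qW); apply: near_eq_cvg; near=> h.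
have Sh : S h by near: h; exact: withinT.
by rewrite /q /= [h *: _ + x]addrC !fg.
Unshelve. all: by end_near.
Qed.

Lemma smooth_on_half_ext f g : (forall y, halfspace R y -> f y = g y) ->
  smooth_on_half g -> smooth_on_half f.
Proof. by move=> fg [g' [Cg gg']]; exists g'; split=> // y Hy; rewrite fg// gg'. Qed.

Lemma smooth_on_half_cst (c : R) : smooth_on_half (fun _ => c).
Proof. by exists (fun _ => c); split=> // k; exact: Ck_cst. Qed.

Lemma smooth_on_half_add f g : smooth_on_half f -> smooth_on_half g ->
  smooth_on_half (fun x => f x + g x).
Proof.
move=> [f' [Cf ff']] [g' [Cg gg']]; exists (fun x => f' x + g' x).
by split=> [k|x Hx]; [exact: Ck_add | rewrite ff' ?gg'].
Qed.

Lemma smooth_on_half_mul f g : smooth_on_half f -> smooth_on_half g ->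
  smooth_on_half (fun x => f x * g x).
Proof.
move=> [f' [Cf ff']] [g' [Cg gg']]; exists (fun x => f' x * g' x).
by split=> [k|x Hx]; [exact: Ck_mul | rewrite ff' ?gg'].
Qed.

Lemma smooth_on_half_partialR i f : smooth_on_half f -> smooth_on_half (partialR i f).
Proof.
move=> [f' [Cf ff']]; exists ('D_(e i) f'); split; first exact: smooth_derive.
by move=> x; exact: partialR_derive.
Qed.

Lemma partialR_ext i f g x : smooth_on_half g ->
  (forall y, halfspace R y -> f y = g y) -> halfspace R x ->
  partialR i f x = partialR i g x.
Proof.
move=> [g' [Cg gg']] fg Hx; rewrite (partialR_derive i Cg gg' Hx).
by apply: partialR_derive => // y Hy; rewrite fg// gg'.
Qed.

Lemma partialR_cst i (c : R) x : halfspace R x -> partialR i (fun _ => c) x = 0.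
Proof.
move=> Hx; rewrite (@partialR_derive _ (fun _ => c))//.
  exact: derive_cst.
by move=> k; exact: Ck_cst.
Qed.

Lemma partialR_add i f g x : smooth_on_half f -> smooth_on_half g ->
  halfspace R x ->
  partialR i (fun y => f y + g y) x = partialR i f x + partialR i g x.
Proof.
move=> [f' [Cf ff']] [g' [Cg gg']] Hx.
rewrite (partialR_derive i Cf ff' Hx) (partialR_derive i Cg gg' Hx).
rewrite (@partialR_derive _ (fun y => f' y + g' y))//.
- by apply: deriveD; exact: smooth_derivable.
- by move=> k; exact: Ck_add.
- by move=> y Hy; rewrite ff'// gg'.
Qed.

Lemma partialR_mul i f g x : smooth_on_half f -> smooth_on_half g ->
  halfspace R x ->
  partialR i (fun y => f y * g y) x = partialR i f x * g x + f x * partialR i g x.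
Proof.
move=> [f' [Cf ff']] [g' [Cg gg']] Hx.
rewrite (partialR_derive i Cf ff' Hx) (partialR_derive i Cg gg' Hx).
rewrite (@partialR_derive _ (fun y => f' y * g' y))//.
- rewrite ff'// gg'// addrC [_ * g' x]mulrC.
  by apply: deriveM; exact: smooth_derivable.
- by move=> k; exact: Ck_mul.
- by move=> y Hy; rewrite ff'// gg'.
Qed.

Lemma partialR_partialR i j f g x : smooth g ->
  (forall y, halfspace R y -> f y = g y) -> halfspace R x ->
  partialR i (partialR j f) x = 'D_(e i) ('D_(e j) g) x.
Proof.
move=> Cg fg Hx.
apply: (partialR_derive i (smooth_derive j Cg) _ Hx) => y Hy.
exact: (partialR_derive j Cg fg Hy).
Qed.

Lemma partialR_comm i j f x : smooth_on_half f -> halfspace R x ->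
  partialR i (partialR j f) x = partialR j (partialR i f) x.
Proof.
move=> [g [Cg fg]] Hx.
rewrite (partialR_partialR i j Cg fg Hx) (partialR_partialR j i Cg fg Hx).
exact: (congr1 (fun h => h x) (smooth_derive_comm i j Cg)).
Qed.

End SmoothOnHalf.

(** * Complex-valued functions *)

Section ComplexPartials.
Local Open Scope ring_scope.
Variable R : realType.
Implicit Types (f g : 'rV[R]_4 -> R[i]) (x : 'rV[R]_4) (i j : 'I_4).

Lemma smooth_on_half_opp (f : 'rV[R]_4 -> R) :
  smooth_on_half f -> smooth_on_half (fun y => - f y).
Proof.
move=> sf; apply: smooth_on_half_ext (smooth_on_half_mul (smooth_on_half_cst (-1)) sf) => y _.
by rewrite mulN1r.
Qed.

Lemma partialR_opp i (f : 'rV[R]_4 -> R) x :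
  smooth_on_half f -> halfspace R x ->
  partialR i (fun y => - f y) x = - partialR i f x.
Proof.
move=> sf Hx; rewrite (partialR_ext i (smooth_on_half_mul (smooth_on_half_cst (-1)) sf) _ Hx).
  by rewrite (partialR_mul i (smooth_on_half_cst (-1)) sf Hx) partialR_cst// mul0r add0r mulN1r.
by move=> y _; rewrite mulN1r.
Qed.

Definition smoothC f :=
  smooth_on_half (fun y => complex.Re (f y)) /\
  smooth_on_half (fun y => complex.Im (f y)).

Lemma ReD (a b : R[i]) : complex.Re (a + b) = complex.Re a + complex.Re b.
Proof. by case: a; case: b. Qed.

Lemma ImD (a b : R[i]) : complex.Im (a + b) = complex.Im a + complex.Im b.
Proof. by case: a; case: b. Qed.

Lemma ReM (a b : R[i]) : complex.Re (a * b) =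
  complex.Re a * complex.Re b + - (complex.Im a * complex.Im b).
Proof. by case: a; case: b. Qed.

Lemma ImM (a b : R[i]) : complex.Im (a * b) =
  complex.Re a * complex.Im b + complex.Im a * complex.Re b.
Proof. by case: a; case: b. Qed.

Lemma complexP (a b : R[i]) :
  complex.Re a = complex.Re b -> complex.Im a = complex.Im b -> a = b.
Proof. by case: a => a a'; case: b => b b' /= -> ->. Qed.

Lemma smoothC_ext f g : (forall y, halfspace R y -> f y = g y) ->
  smoothC g -> smoothC f.
Proof.
by move=> fg [gr gi]; split; [apply: smooth_on_half_ext gr|apply: smooth_on_half_ext gi] => y Hy;
  rewrite fg.
Qed.

Lemma smoothC_cst (c : R[i]) : smoothC (fun _ => c).
Proof. by split; exact: smooth_on_half_cst. Qed.

Lemma smoothC_add f g : smoothC f -> smoothC g -> smoothC (fun y => f y + g y).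
Proof.
move=> [fr fi] [gr gi]; split.
  by apply: smooth_on_half_ext (smooth_on_half_add fr gr) => y _; exact: ReD.
by apply: smooth_on_half_ext (smooth_on_half_add fi gi) => y _; exact: ImD.
Qed.

Lemma smoothC_mul f g : smoothC f -> smoothC g -> smoothC (fun y => f y * g y).
Proof.
move=> [fr fi] [gr gi]; split.
  apply: smooth_on_half_ext (smooth_on_half_add (smooth_on_half_mul fr gr) (smooth_on_half_opp (smooth_on_half_mul fi gi))) => y _.
  exact: ReM.
by apply: smooth_on_half_ext (smooth_on_half_add (smooth_on_half_mul fr gi) (smooth_on_half_mul fi gr)) => y _; exact: ImM.
Qed.

Lemma smoothC_partialC i f : smoothC f -> smoothC (partialC i f).
Proof. by move=> [fr fi]; split; exact: smooth_on_half_partialR. Qed.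

Lemma partialC_ext i f g x : smoothC g ->
  (forall y, halfspace R y -> f y = g y) -> halfspace R x ->
  partialC i f x = partialC i g x.
Proof.
by move=> [gr gi] fg Hx; apply: complexP;
  [apply: (partialR_ext i gr)|apply: (partialR_ext i gi)] => // y Hy;
  rewrite fg.
Qed.

Lemma partialC_cst i (c : R[i]) x : halfspace R x ->
  partialC i (fun _ => c) x = 0.
Proof. by move=> Hx; apply: complexP; rewrite /= partialR_cst. Qed.

Lemma partialC_add i f g x : smoothC f -> smoothC g -> halfspace R x ->
  partialC i (fun y => f y + g y) x = partialC i f x + partialC i g x.
Proof.
move=> [fr fi] [gr gi] Hx; apply: complexP; rewrite ?ReD ?ImD /=.
  rewrite -partialR_add//.
  by apply: (partialR_ext i (smooth_on_half_add fr gr) _ Hx) => y _; exact: ReD.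
rewrite -partialR_add//.
by apply: (partialR_ext i (smooth_on_half_add fi gi) _ Hx) => y _; exact: ImD.
Qed.

Lemma partialC_mul i f g x : smoothC f -> smoothC g -> halfspace R x ->
  partialC i (fun y => f y * g y) x =
  partialC i f x * g x + f x * partialC i g x.
Proof.
move=> [fr fi] [gr gi] Hx; apply: complexP; rewrite ?ReD ?ImD ?ReM ?ImM /=.
  have sr := smooth_on_half_mul fr gr; have si := smooth_on_half_mul fi gi; have so := smooth_on_half_opp si.
  rewrite (partialR_ext i (smooth_on_half_add sr so) (fun y _ => ReM (f y) (g y)) Hx).
  rewrite (partialR_add i sr so Hx) (partialR_opp i si Hx).
  rewrite (partialR_mul i fr gr Hx) (partialR_mul i fi gi Hx).
  by rewrite opprD addrACA.
have sr := smooth_on_half_mul fr gi; have si := smooth_on_half_mul fi gr.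
rewrite (partialR_ext i (smooth_on_half_add sr si) (fun y _ => ImM (f y) (g y)) Hx).
rewrite (partialR_add i sr si Hx).
rewrite (partialR_mul i fr gi Hx) (partialR_mul i fi gr Hx).
by rewrite addrACA.
Qed.

Lemma partialC_conj i f x : smoothC f -> halfspace R x ->
  partialC i (fun y => conjc (f y)) x = conjc (partialC i f x).
Proof.
have Rec (a : R[i]) : complex.Re (conjc a) = complex.Re a by case: a.
have Imc (a : R[i]) : complex.Im (conjc a) = - complex.Im a by case: a.
move=> [fr fi] Hx; apply: complexP; rewrite ?Rec ?Imc /=.
  exact: (partialR_ext i fr (fun y _ => Rec (f y)) Hx).
rewrite (partialR_ext i (smooth_on_half_opp fi) (fun y _ => Imc (f y)) Hx).
exact: partialR_opp.
Qed.

Lemma partialC_comm i j f x : smoothC f -> halfspace R x ->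
  partialC i (partialC j f) x = partialC j (partialC i f) x.
Proof.
move=> [fr fi] Hx; apply: complexP.
  exact: (partialR_comm i j fr Hx).
exact: (partialR_comm i j fi Hx).
Qed.

End ComplexPartials.

(** * Matrix-valued fields *)

Section MatrixPartials.
Local Open Scope ring_scope.
Variable R : realType.
Implicit Types (s t : 'rV[R]_4 -> 'M[R[i]]_2) (x : 'rV[R]_4) (i j : 'I_4).
Implicit Types (P Q : 'M[R[i]]_2).

Lemma mulmx2E P Q k l :
  (P *m Q) k l = P k ord0 * Q ord0 l + P k ord_max * Q ord_max l.
Proof.
rewrite mxE !big_ord_recl big_ord0 addr0.
by congr (_ + P k _ * Q _ l); apply/val_inj.
Qed.

Lemma mxtrace2E P : \tr P = P ord0 ord0 + P ord_max ord_max.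
Proof.
rewrite /mxtrace !big_ord_recl big_ord0 addr0.
by congr (_ + P _ _); apply/val_inj.
Qed.

Lemma smooth_field_ext s t : (forall y, halfspace R y -> s y = t y) ->
  smooth_field t -> smooth_field s.
Proof. by move=> st ts k l; apply: smoothC_ext (ts k l) => y Hy; rewrite st. Qed.

Lemma smooth_field_cst P : smooth_field (fun _ : 'rV[R]_4 => P).
Proof. by move=> k l; exact: (smoothC_cst (P k l)). Qed.

Lemma smooth_field_add s t : smooth_field s -> smooth_field t ->
  smooth_field (fun y => s y + t y).
Proof.
move=> ss st k l; apply: smoothC_ext (smoothC_add (ss k l) (st k l)) => y _.
by rewrite mxE.
Qed.

Lemma smooth_field_scale (c : R[i]) s : smooth_field s ->
  smooth_field (fun y => c *: s y).
Proof.
move=> ss k l; apply: smoothC_ext (smoothC_mul (smoothC_cst c) (ss k l)) => y _.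
by rewrite mxE.
Qed.

Lemma smooth_field_opp s : smooth_field s -> smooth_field (fun y => - s y).
Proof.
move=> ss; apply: smooth_field_ext (smooth_field_scale (-1) ss) => y _.
by rewrite scaleN1r.
Qed.

Lemma smooth_field_sub s t : smooth_field s -> smooth_field t ->
  smooth_field (fun y => s y - t y).
Proof. by move=> ss st; apply: smooth_field_add => //; exact: smooth_field_opp. Qed.

Lemma smooth_field_mulmx s t : smooth_field s -> smooth_field t ->
  smooth_field (fun y => s y *m t y).
Proof.
move=> ss st k l.
apply: smoothC_ext (smoothC_add (smoothC_mul (ss k ord0) (st ord0 l))
  (smoothC_mul (ss k ord_max) (st ord_max l))) => y _.
exact: mulmx2E.
Qed.

Lemma smooth_field_partial i s : smooth_field s -> smooth_field (partial i s).
Proof.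
move=> ss k l; apply: smoothC_ext (smoothC_partialC i (ss k l)) => y _.
by rewrite mxE.
Qed.

Lemma partial_ext i s t x : smooth_field t ->
  (forall y, halfspace R y -> s y = t y) -> halfspace R x ->
  partial i s x = partial i t x.
Proof.
move=> tt st Hx; apply/matrixP => k l; rewrite !mxE.
by apply: (partialC_ext i (tt k l) _ Hx) => y Hy; rewrite st.
Qed.

Lemma partial_add i s t x : smooth_field s -> smooth_field t ->
  halfspace R x -> partial i (fun y => s y + t y) x = partial i s x + partial i t x.
Proof.
move=> ss st Hx; apply/matrixP => k l; rewrite !mxE.
rewrite -(partialC_add i (ss k l) (st k l) Hx).
apply: (partialC_ext i (smoothC_add (ss k l) (st k l)) _ Hx) => y _.
by rewrite mxE.
Qed.

Lemma partial_scale i (c : R[i]) s x : smooth_field s -> halfspace R x ->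
  partial i (fun y => c *: s y) x = c *: partial i s x.
Proof.
move=> ss Hx; apply/matrixP => k l; rewrite !mxE.
have sc := smoothC_mul (smoothC_cst c) (ss k l).
rewrite (partialC_ext i sc _ Hx); last by move=> y _; rewrite mxE.
by rewrite (partialC_mul i (smoothC_cst c) (ss k l) Hx) partialC_cst// mul0r add0r.
Qed.

Lemma partial_opp i s x : smooth_field s -> halfspace R x ->
  partial i (fun y => - s y) x = - partial i s x.
Proof.
move=> ss Hx; rewrite -scaleN1r -(partial_scale i (-1) ss Hx).
apply: (partial_ext i (smooth_field_scale (-1) ss) _ Hx) => y _.
by rewrite scaleN1r.
Qed.

Lemma partial_sub i s t x : smooth_field s -> smooth_field t ->
  halfspace R x -> partial i (fun y => s y - t y) x = partial i s x - partial i t x.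
Proof.
move=> ss st Hx; rewrite -(partial_opp i st Hx).
exact: (partial_add i ss (smooth_field_opp st) Hx).
Qed.

Lemma partial_mulmx i s t x : smooth_field s -> smooth_field t ->
  halfspace R x ->
  partial i (fun y => s y *m t y) x = partial i s x *m t x + s x *m partial i t x.
Proof.
move=> ss st Hx; apply/matrixP => k l; rewrite mxE [RHS]mxE !mulmx2E !mxE.
have s1 := smoothC_mul (ss k ord0) (st ord0 l).
have s2 := smoothC_mul (ss k ord_max) (st ord_max l).
rewrite (partialC_ext i (smoothC_add s1 s2) _ Hx).
  rewrite (partialC_add i s1 s2 Hx).
  rewrite (partialC_mul i (ss k ord0) (st ord0 l) Hx).
  rewrite (partialC_mul i (ss k ord_max) (st ord_max l) Hx).
  exact: addrACA.
by move=> y _; exact: mulmx2E.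
Qed.

Lemma partialC_tr i s x : smooth_field s -> halfspace R x ->
  partialC i (fun y => \tr (s y)) x = \tr (partial i s x).
Proof.
move=> ss Hx; rewrite mxtrace2E !mxE.
have s1 := ss ord0 ord0; have s2 := ss ord_max ord_max.
rewrite -(partialC_add i s1 s2 Hx).
apply: (partialC_ext i (smoothC_add s1 s2) _ Hx) => y _.
exact: mxtrace2E.
Qed.

Lemma partialC_trD a s t x : smooth_field s -> smooth_field t ->
  halfspace R x -> partialC a (fun y => \tr (s y + t y)) x =
  partialC a (fun y => \tr (s y)) x + partialC a (fun y => \tr (t y)) x.
Proof.
move=> ss st Hx; rewrite (partialC_tr a (smooth_field_add ss st) Hx).
by rewrite (partial_add a ss st Hx) linearD /= -!partialC_tr.
Qed.

Lemma partialC_trN a s x : smooth_field s -> halfspace R x ->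
  partialC a (fun y => \tr (- s y)) x = - partialC a (fun y => \tr (s y)) x.
Proof.
move=> ss Hx; rewrite (partialC_tr a (smooth_field_opp ss) Hx).
by rewrite (partial_opp a ss Hx) linearN /= -partialC_tr.
Qed.

Lemma partial_comm i j s x : smooth_field s -> halfspace R x ->
  partial i (partial j s) x = partial j (partial i s) x.
Proof.
move=> ss Hx; have E a b k l :
    partial a (partial b s) x k l = partialC a (partialC b (fun y => s y k l)) x.
  rewrite mxE.
  apply: (partialC_ext a (smoothC_partialC b (ss k l)) _ Hx) => y _.
  by rewrite mxE.
apply/matrixP => k l.
exact: (etrans (E i j k l) (etrans (partialC_comm i j (ss k l) Hx)
  (esym (E j i k l)))).
Qed.

Lemma partial_adjoint i s x : smooth_field s -> halfspace R x ->
  partial i (fun y => adjoint (s y)) x = adjoint (partial i s x).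
Proof.
move=> ss Hx; apply/matrixP => k l; rewrite !mxE.
rewrite -(partialC_conj i (ss l k) Hx).
by congr (partialC i _ x); apply/funext => y; rewrite !mxE.
Qed.

Lemma su2_partial i s x : smooth_field s ->
  (forall y, halfspace R y -> su2 (s y)) -> halfspace R x ->
  su2 (partial i s x).
Proof.
move=> ss su Hx; split.
  rewrite -(partial_adjoint i ss Hx) -(partial_opp i ss Hx).
  by apply: (partial_ext i (smooth_field_opp ss) _ Hx) => y /su[].
rewrite -(partialC_tr i ss Hx) -(partialC_cst i 0 Hx).
by apply: (partialC_ext i (smoothC_cst 0) _ Hx) => y /su[].
Qed.

End MatrixPartials.

(** * The Lie bracket and the trace form *)

Section Bracket.
Local Open Scope ring_scope.
Variable R : realType.
Implicit Types P Q S T : 'M[R[i]]_2.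

Lemma lieDl P Q S : lie (P + Q) S = lie P S + lie Q S.
Proof. by rewrite /lie mulmxDl mulmxDr opprD addrACA. Qed.

Lemma lieDr P Q S : lie S (P + Q) = lie S P + lie S Q.
Proof. by rewrite /lie mulmxDl mulmxDr opprD addrACA. Qed.

Lemma lieC P Q : lie Q P = - lie P Q.
Proof. by rewrite /lie opprB. Qed.

Lemma liexx P : lie P P = 0.
Proof. exact: subrr. Qed.

Lemma lieZl (c : R[i]) P Q : lie (c *: P) Q = c *: lie P Q.
Proof. by rewrite /lie scalerBr -scalemxAl -scalemxAr. Qed.

Lemma lieZr (c : R[i]) P Q : lie P (c *: Q) = c *: lie P Q.
Proof. by rewrite /lie scalerBr -scalemxAl -scalemxAr. Qed.

Lemma lieNl P Q : lie (- P) Q = - lie P Q.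
Proof. by rewrite -scaleN1r lieZl scaleN1r. Qed.

Lemma lie_jacobi P Q S : lie P (lie Q S) = lie (lie P Q) S + lie Q (lie P S).
Proof.
rewrite /lie !(mulmxBl, mulmxBr, mulmxA) !opprB !addrA.
apply/eqP; rewrite -subr_eq0; apply/eqP/matrixP => k l.
by rewrite !mxE; ring.
Qed.

Lemma lie_jacobi_cycle P Q S :
  lie P (lie Q S) + lie Q (lie S P) + lie S (lie P Q) = 0.
Proof.
rewrite (lie_jacobi P) (lieC (lie P Q) S) (lieC P S).
by rewrite -[- lie P S]scaleN1r lieZr scaleN1r addrK subrr.
Qed.

Lemma lieBr_swap P Q S : lie P (Q - S) = lie S P - lie Q P.
Proof. by rewrite lieC lieDl lieNl opprD opprK addrC. Qed.

Lemma tr_lie P Q : \tr (lie P Q) = 0.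
Proof. by rewrite /lie linearB /= mxtrace_mulC subrr. Qed.

Lemma tr2C P Q : tr2 P Q = tr2 Q P.
Proof. exact: mxtrace_mulC. Qed.

Lemma tr2Dl P Q S : tr2 (P + Q) S = tr2 P S + tr2 Q S.
Proof. by rewrite /tr2 mulmxDl linearD. Qed.

Lemma tr2Dr P Q S : tr2 S (P + Q) = tr2 S P + tr2 S Q.
Proof. by rewrite /tr2 mulmxDr linearD. Qed.

Lemma tr2Nr P Q : tr2 P (- Q) = - tr2 P Q.
Proof. by rewrite /tr2 mulmxN linearN. Qed.

Lemma tr2Zl (c : R[i]) P Q : tr2 (c *: P) Q = c * tr2 P Q.
Proof. by rewrite /tr2 -scalemxAl linearZ. Qed.

Lemma tr2Zr (c : R[i]) P Q : tr2 P (c *: Q) = c * tr2 P Q.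
Proof. by rewrite /tr2 -scalemxAr linearZ. Qed.

Lemma tr2_lie P Q S : tr2 P (lie Q S) = tr2 (lie P Q) S.
Proof.
rewrite /tr2 /lie mulmxBl mulmxBr !linearB /= !mulmxA.
by rewrite -(mulmxA Q P S) (mxtrace_mulC Q).
Qed.

Lemma subrACA (W : zmodType) (a b c d : W) : a + b - (c + d) = a - c + (b - d).
Proof. by rewrite opprD addrACA. Qed.

Lemma tr2_cycle (P Q S : 'M[R[i]]_2) : tr2 P (lie Q S) = tr2 Q (lie S P).
Proof. by rewrite [RHS]tr2_lie tr2C. Qed.

(** This and the next two lemmas pair a Bianchi identity with a fixed field; the
    signs come from exchanging the two indices of a curvature. *)
Lemma tr2_eq0 (S P Q T : 'M[R[i]]_2) :
  P + Q + T = 0 -> tr2 S P + tr2 S Q + tr2 S T = 0.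
Proof. by move=> E; rewrite -!tr2Dr E /tr2 mulmx0 linear0. Qed.

Lemma tr2_eq0N (S P Q T : 'M[R[i]]_2) :
  P - Q + T = 0 -> tr2 S P - tr2 S Q + tr2 S T = 0.
Proof. by move/tr2_eq0 => /(_ S); rewrite tr2Nr. Qed.

Lemma tr2_eq0NN (S P Q T : 'M[R[i]]_2) :
  P - Q - T = 0 -> tr2 S P - tr2 S Q - tr2 S T = 0.
Proof. by move/tr2_eq0 => /(_ S); rewrite !tr2Nr. Qed.

Lemma su2D P Q : su2 P -> su2 Q -> su2 (P + Q).
Proof.
move=> [aP tP] [aQ tQ]; split; last by rewrite linearD /= tP tQ addr0.
rewrite opprD -aP -aQ; apply/matrixP => k l; rewrite !mxE; exact: rmorphD.
Qed.

Lemma su2N P : su2 P -> su2 (- P).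
Proof.
move=> [aP tP]; split; last by rewrite linearN /= tP oppr0.
rewrite -[in RHS]aP; apply/matrixP => k l; rewrite !mxE; exact: rmorphN.
Qed.

Lemma su2B P Q : su2 P -> su2 Q -> su2 (P - Q).
Proof. by move=> sP sQ; apply: su2D => //; exact: su2N. Qed.

Lemma adjoint_mulmx P Q : adjoint (P *m Q) = adjoint Q *m adjoint P.
Proof.
apply/matrixP => k l; rewrite mulmx2E.
rewrite [LHS]mxE [X in X = _]mxE mulmx2E rmorphD !rmorphM /= !mxE.
by congr (_ + _); exact: mulrC.
Qed.

Lemma su2_lie P Q : su2 P -> su2 Q -> su2 (lie P Q).
Proof.
move=> [aP _] [aQ _]; split; last exact: tr_lie.
have -> : adjoint (lie P Q) = adjoint (P *m Q) - adjoint (Q *m P).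
  by apply/matrixP => k l; rewrite /lie !mxE; exact: rmorphB.
by rewrite !adjoint_mulmx aP aQ !mulNmx !mulmxN !opprK /lie opprB.
Qed.

End Bracket.

(** * Covariant derivatives and curvature *)

Section Covariant.
Local Open Scope ring_scope.
Variable R : realType.
Variable A : 'I_4 -> 'rV[R]_4 -> 'M[R[i]]_2.
Hypothesis sA : forall i, smooth_field (A i).
Implicit Types (s t : 'rV[R]_4 -> 'M[R[i]]_2) (x : 'rV[R]_4) (i j k : 'I_4).

Lemma smooth_field_lie s t : smooth_field s -> smooth_field t ->
  smooth_field (fun y => lie (s y) (t y)).
Proof. by move=> ss st; apply: smooth_field_sub; exact: smooth_field_mulmx. Qed.

Lemma partial_lie i s t x : smooth_field s -> smooth_field t ->
  halfspace R x -> partial i (fun y => lie (s y) (t y)) x =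
    lie (partial i s x) (t x) + lie (s x) (partial i t x).
Proof.
move=> ss st Hx.
rewrite (partial_sub i (smooth_field_mulmx ss st) (smooth_field_mulmx st ss) Hx).
rewrite (partial_mulmx i ss st Hx) (partial_mulmx i st ss Hx) /lie.
by rewrite (addrC (_ *m s x)) opprD addrACA.
Qed.

Lemma smooth_field_D i s : smooth_field s -> smooth_field (D A i s).
Proof.
move=> ss; apply: smooth_field_add; first exact: smooth_field_partial.
exact: smooth_field_lie.
Qed.

Lemma smooth_field_F i j : smooth_field (F A i j).
Proof.
apply: smooth_field_add; last exact: smooth_field_lie.
by apply: smooth_field_sub; exact: smooth_field_partial.
Qed.

Lemma D_add i s t x : smooth_field s -> smooth_field t -> halfspace R x ->
  D A i (fun y => s y + t y) x = D A i s x + D A i t x.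
Proof.
by move=> ss st Hx; rewrite /D (partial_add i ss st Hx) lieDr addrACA.
Qed.

Lemma D_scale i (c : R[i]) s x : smooth_field s -> halfspace R x ->
  D A i (fun y => c *: s y) x = c *: D A i s x.
Proof.
by move=> ss Hx; rewrite /D (partial_scale i c ss Hx) lieZr -scalerDr.
Qed.

Lemma smooth_field_subZ (c : R[i]) s t : smooth_field s -> smooth_field t ->
  smooth_field (fun y : 'rV[R]_4 => s y - c *: t y).
Proof.
by move=> ss st; apply: smooth_field_sub => //; exact: smooth_field_scale.
Qed.

Lemma D_subZ i (c : R[i]) s t x : smooth_field s -> smooth_field t ->
  halfspace R x ->
  D A i (fun y => s y - c *: t y) x = D A i s x - c *: D A i t x.
Proof.
move=> ss st Hx; have sc := smooth_field_scale (- c) st.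
have E := etrans (D_add i ss sc Hx)
  (congr1 (fun M => D A i s x + M) (D_scale i (- c) st Hx)).
rewrite scaleNr in E; rewrite -E; congr (D A i _ x).
by apply/funext => y; rewrite scaleNr.
Qed.

Lemma D_lie i s t x : smooth_field s -> smooth_field t -> halfspace R x ->
  D A i (fun y => lie (s y) (t y)) x = lie (D A i s x) (t x) + lie (s x) (D A i t x).
Proof.
move=> ss st Hx; rewrite /D (partial_lie i ss st Hx) lie_jacobi.
by rewrite lieDl lieDr addrACA.
Qed.

(** The second derivatives of s cancel by symmetry, the mixed terms
    [A_i, partial_j s] cancel in pairs, and the Jacobi identity turns the double
    brackets into the bracket with [A_i, A_j]. *)
Lemma D_comm i j s x : smooth_field s -> halfspace R x ->
  D A i (D A j s) x - D A j (D A i s) x = lie (F A i j x) (s x).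
Proof.
move=> ss Hx.
have E a b : D A a (D A b s) x = partial a (partial b s) x
    + (lie (partial a (A b) x) (s x) + lie (A b x) (partial a s x))
    + (lie (A a x) (partial b s x) + lie (A a x) (lie (A b x) (s x))).
  rewrite {1}/D (partial_add a (smooth_field_partial b ss) _ Hx).
    by rewrite (partial_lie a (sA b) ss Hx) [D A b s x]/D lieDr.
  exact: smooth_field_lie.
rewrite !E (partial_comm i j ss Hx) /F lieDl lieDl lieNl.
rewrite (lie_jacobi (A i x) (A j x)).
(* The rest is linear in the brackets, which may be taken as unknowns. *)
repeat match goal with |- context [lie ?P ?Q] =>
  generalize (lie P Q); intro end.
generalize (partial j (partial i s) x) => p.
apply/matrixP => k l; rewrite !mxE; ring.
Qed.

(** The connection terms Tr ([A_i, s] t) + Tr (s [A_i, t]) vanish because the trace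
    form is invariant. *)
Lemma partialC_tr2 i s t x : smooth_field s -> smooth_field t ->
  halfspace R x -> partialC i (fun y => tr2 (s y) (t y)) x =
    tr2 (D A i s x) (t x) + tr2 (s x) (D A i t x).
Proof.
move=> ss st Hx; rewrite (partialC_tr i (smooth_field_mulmx ss st) Hx).
rewrite (partial_mulmx i ss st Hx) linearD /= /D tr2Dl tr2Dr.
rewrite [tr2 (s x) (lie _ _)]tr2_lie (lieC (A i x) (s x)).
rewrite /tr2 mulNmx linearN /=; ring.
Qed.

Lemma F_antisym i j x : F A j i x = - F A i j x.
Proof. by rewrite /F (lieC (A i x)) [RHS]opprD [in RHS]opprB. Qed.

Lemma D_F_antisym a b c x : halfspace R x ->
  D A a (F A c b) x = - D A a (F A b c) x.
Proof.
move=> Hx; rewrite -scaleN1r -(D_scale a (-1) (smooth_field_F b c) Hx).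
by congr (D A a _ x); apply/funext => y; rewrite F_antisym scaleN1r.
Qed.

(** Expanded in A, the second derivatives cancel by symmetry, the brackets of A
    with its first derivatives cancel in pairs, and the cubic terms cancel by the
    Jacobi identity. *)
Lemma bianchi i j k x : halfspace R x ->
  D A i (F A j k) x + D A j (F A k i) x + D A k (F A i j) x = 0.
Proof.
move=> Hx.
have E a b c : D A a (F A b c) x =
    (partial a (partial b (A c)) x - partial a (partial c (A b)) x)
    + (lie (partial a (A b) x) (A c x) - lie (partial a (A c) x) (A b x))
    + (lie (partial c (A b) x) (A a x) - lie (partial b (A c) x) (A a x))
    + lie (A a x) (lie (A b x) (A c x)).
  have sd := smooth_field_partial b (sA c).
  have sd' := smooth_field_partial c (sA b).
  rewrite {1}/D (partial_add a (smooth_field_sub sd sd') _ Hx); last first.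
    exact: smooth_field_lie.
  rewrite (partial_sub a sd sd' Hx) (partial_lie a (sA b) (sA c) Hx).
  rewrite [F A b c x]/F lieDr.
  rewrite (lieC (partial a (A c) x) (A b x)).
  rewrite -[RHS]addrA; congr (_ + (_ + _)); exact: lieBr_swap.
rewrite !E (partial_comm j i (sA k) Hx) (partial_comm k j (sA i) Hx).
rewrite (partial_comm i k (sA j) Hx).
have := lie_jacobi_cycle (A i x) (A j x) (A k x).
(* The double brackets go first: each is an unknown occurring in the Jacobi
   identity, and only then are the remaining single brackets abstracted. *)
repeat match goal with |- context [lie (A ?a x) (lie ?P ?Q)] =>
  generalize (lie (A a x) (lie P Q)); intro end.
repeat match goal with |- context [lie (partial ?a ?b x) ?Q] =>
  generalize (lie (partial a b x) Q); intro end.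
repeat match goal with |- context [partial ?a ?b x] =>
  generalize (partial a b x); intro end.
move=> J; rewrite -[RHS]J; apply/matrixP => k' l'; rewrite !mxE; ring.
Qed.

End Covariant.

(** * The commutators of the complexified operators *)

Section OperatorCommutators.
Local Open Scope ring_scope.
Variable R : realType.
Implicit Types (M P Q : 'M[R[i]]_2) (x : 'rV[R]_4) (i j : 'I_4).

(** The two elementary nilpotent matrices already detect a nonzero M. *)
Lemma sl2_centre M :
  (forall Q, sl2 Q -> lie M Q = 0) -> sl2 M -> M = 0.
Proof.
move=> cM; rewrite /sl2 mxtrace2E => trM.
have t01 : sl2 (delta_mx ord0 ord_max : 'M[R[i]]_2).
  by rewrite /sl2 mxtrace2E !mxE /= addr0.
have t10 : sl2 (delta_mx ord_max ord0 : 'M[R[i]]_2).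
  by rewrite /sl2 mxtrace2E !mxE /= addr0.
have c01 := cM _ t01; have c10 := cM _ t10.
have e00 := congr1 (fun N : 'M[R[i]]_2 => N ord0 ord0) c01.
have e01 := congr1 (fun N : 'M[R[i]]_2 => N ord0 ord_max) c01.
have f00 := congr1 (fun N : 'M[R[i]]_2 => N ord0 ord0) c10.
have lieE a b Q : lie M Q a b = (M *m Q) a b - (Q *m M) a b by rewrite !mxE.
move: e00 e01 f00; rewrite !lieE !mulmx2E !mxE /=.
rewrite !(mulr0, mul0r, mulr1, mul1r, addr0, add0r, subr0, sub0r) => e00 e01 f00.
have M11 := subr0_eq e01.
have M00 : M ord0 ord0 = 0.
  by move/eqP: trM; rewrite -M11 -mulr2n mulrn_eq0 => /eqP.
have ord2P (k : 'I_2) : k = ord0 \/ k = ord_max.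
  by case: k => [[|[|//]] ?]; [left|right]; apply/val_inj.
apply/matrixP => k l; rewrite [RHS]mxE.
have [->|->] := ord2P k; have [->|->] := ord2P l => //.
- by rewrite -[LHS]opprK e00 oppr0.
- by rewrite -M11.
Qed.

(** Uniqueness is tested on constant sections, whose values exhaust sl(2, C). *)
Lemma opcommE (S T : ('rV[R]_4 -> 'M[R[i]]_2) -> 'rV[R]_4 -> 'M[R[i]]_2) x M :
  sl2 M ->
  (forall s, smooth_field s -> (forall y, halfspace R y -> sl2 (s y)) ->
     S (T s) x - T (S s) x = lie M (s x)) ->
  halfspace R x -> opcomm S T x = M.
Proof.
move=> slM STM Hx; apply: xget_unique; first by split.
move=> N [slN STN]; apply/eqP; rewrite -subr_eq0; apply/eqP.
apply: sl2_centre; last by rewrite /sl2 linearB /= slN slM subrr.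
move=> Q slQ; rewrite lieDl lieNl.
have sQ := smooth_field_cst Q.
by rewrite -(STN _ sQ (fun _ _ => slQ)) -(STM _ sQ (fun _ _ => slQ)) subrr.
Qed.

Lemma sl2_complex P Q : su2 P -> su2 Q -> sl2 (P + 'i%C *: Q).
Proof.
by move=> [_ tP] [_ tQ]; rewrite /sl2 linearD linearZ /= tP tQ mulr0 addr0.
Qed.

Lemma tr_conj_su P Q : su2 P -> su2 Q ->
  \tr ((P + 'i%C *: Q) *m conj_su (P + 'i%C *: Q)) = tr2 P P + tr2 Q Q.
Proof.
move=> sP sQ; rewrite conj_suE// -/(tr2 _ _) -scaleNr.
rewrite tr2Dl !tr2Dr !tr2Zl !tr2Zr (tr2C Q P) mulrA mulrN -expr2 sqr_i opprK.
by ring.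
Qed.

(** The three lemmas below are the pointwise algebra of [D_1, D_2], [D_2, D_3] and
    [D_3, D_1] for the complexified operators, once the derivatives of
    the brackets have been expanded.  Here v is the value of a section, v2, v3, v4
    are its covariant derivatives and w_ab its second covariant derivatives. *)
Lemma bracket12 (F24 F34 G2 G3 f v v2 v3 w24 w42 w34 w43 : 'M[R[i]]_2) :
  w24 - w42 = lie F24 v -> w34 - w43 = lie F34 v ->
  w24 - 'i%C *: (lie G2 v + lie f v2) + 'i%C *: (w34 - 'i%C *: (lie G3 v + lie f v3))
  - (w42 + 'i%C *: w43 - 'i%C *: lie f (v2 + 'i%C *: v3)) =
  lie (F24 + G3 + 'i%C *: (F34 - G2)) v.
Proof.
move=> /(canRL (subrK _)) -> /(canRL (subrK _)) ->.
rewrite !(lieDl, lieNl, lieZl) lieDr lieZr.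
repeat match goal with |- context [lie ?P ?Q] => generalize (lie P Q); intro end.
by apply/matrixP => k l; rewrite !mxE; ring: (sqr_i R).
Qed.

Lemma bracket23 (G2 G3 f1 f2 f3 v v4 : 'M[R[i]]_2) :
  lie (G2 - 'i%C *: G3) v + lie (f2 - 'i%C *: f3) v4
  - 'i%C *: lie f1 (lie (f2 - 'i%C *: f3) v)
  - lie (f2 - 'i%C *: f3) (v4 - 'i%C *: lie f1 v) =
  lie (G2 - lie f1 f3 + 'i%C *: - (G3 + lie f1 f2)) v.
Proof.
rewrite (lie_jacobi f1); set h := f2 - _.
have -> : lie h (v4 - 'i%C *: lie f1 v) = lie h v4 - 'i%C *: lie h (lie f1 v).
  by rewrite -scaleNr lieDr lieZr scaleNr.
have -> : lie f1 h = lie f1 f2 - 'i%C *: lie f1 f3.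
  by rewrite /h -scaleNr lieDr lieZr scaleNr.
move: (lie f1 f2) (lie f1 f3) (lie h v4) (lie h (lie f1 v)) => L2 L3 a b.
rewrite !(lieDl, lieNl, lieZl).
repeat match goal with |- context [lie ?P ?Q] => generalize (lie P Q); intro end.
by apply/matrixP => k l; rewrite !mxE; ring: (sqr_i R).
Qed.

Lemma bracket31 (G22 G23 G32 G33 h v v2 v3 : 'M[R[i]]_2) :
  lie h (v2 + 'i%C *: v3)
  - (lie (G22 - 'i%C *: G23) v + lie h v2
     + 'i%C *: (lie (G32 - 'i%C *: G33) v + lie h v3)) =
  lie (- (G22 + G33) + 'i%C *: (G23 - G32)) v.
Proof.
rewrite lieDr lieZr !(lieDl, lieNl, lieZl).
repeat match goal with |- context [lie ?P ?Q] => generalize (lie P Q); intro end.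
by apply/matrixP => k l; rewrite !mxE; ring: (sqr_i R).
Qed.

Variables A phi : 'I_4 -> 'rV[R]_4 -> 'M[R[i]]_2.
Hypothesis hA : su2_form A.
Hypothesis hphi : su2_form phi.

Let sA i : smooth_field (A i). Proof. exact: (hA i).1. Qed.
Let sphi i : smooth_field (phi i). Proof. exact: (hphi i).1. Qed.

Lemma su2_F i j x : halfspace R x -> su2 (F A i j x).
Proof.
move=> Hx; apply: su2D; last by apply: su2_lie; [exact: (hA i).2|exact: (hA j).2].
by apply: su2B; apply: su2_partial => //; [exact: (hA j).2|exact: (hA i).2].
Qed.

Lemma su2_D i j x : halfspace R x -> su2 (D A i (phi j) x).
Proof.
move=> Hx; apply: su2D; last first.
  by apply: su2_lie; [exact: (hA i).2|exact: (hphi j).2].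
by apply: su2_partial => //; exact: (hphi j).2.
Qed.

Lemma su2_bracket i j x : halfspace R x -> su2 (lie (phi i x) (phi j x)).
Proof. by move=> Hx; apply: su2_lie; [exact: (hphi i).2|exact: (hphi j).2]. Qed.

Lemma D_cD1 i s x : smooth_field s -> halfspace R x ->
  D A i (cD1 A phi s) x = D A i (D A i2 s) x + 'i%C *: D A i (D A i3 s) x.
Proof.
move=> ss Hx; have s2 := smooth_field_D sA i2 ss; have s3 := smooth_field_D sA i3 ss.
by rewrite /cD1 (D_add A i s2 (smooth_field_scale _ s3) Hx) (D_scale A i _ s3 Hx).
Qed.

Lemma D_cD2 i s x : smooth_field s -> halfspace R x ->
  D A i (cD2 A phi s) x = D A i (D A i4 s) x
    - 'i%C *: (lie (D A i (phi i1) x) (s x) + lie (phi i1 x) (D A i s x)).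
Proof.
move=> ss Hx; have s4 := smooth_field_D sA i4 ss.
have sl := smooth_field_lie (sphi i1) ss.
exact: (etrans (D_subZ A i _ s4 sl Hx)
  (congr1 (fun M => D A i (D A i4 s) x - 'i%C *: M) (D_lie A i (sphi i1) ss Hx))).
Qed.

Lemma D_cD3 i s x : smooth_field s -> halfspace R x ->
  D A i (cD3 A phi s) x =
    lie (D A i (phi i2) x - 'i%C *: D A i (phi i3) x) (s x)
    + lie (phi i2 x - 'i%C *: phi i3 x) (D A i s x).
Proof.
move=> ss Hx; have sc := smooth_field_subZ 'i%C (sphi i2) (sphi i3).
apply: (etrans (D_lie A i sc ss Hx)).
exact: (congr1 (fun M => lie M (s x) + _) (D_subZ A i _ (sphi i2) (sphi i3) Hx)).
Qed.

(** D_2 + i D_3 and D_4 - i [phi_1, .] give F_24 + i F_34 from the covariant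
    derivatives, and - i (D_2 + i D_3) phi_1 from differentiating phi_1. *)
Lemma calXE x : halfspace R x -> calX A phi x =
  (F A i2 i4 x + D A i3 (phi i1) x) + 'i%C *: (F A i3 i4 x - D A i2 (phi i1) x).
Proof.
move=> Hx; apply: opcommE => //.
  by apply: sl2_complex; [apply: su2D|apply: su2B]; try exact: su2_F; exact: su2_D.
move=> s ss _.
have e1 : cD1 A phi (cD2 A phi s) x =
  D A i2 (cD2 A phi s) x + 'i%C *: D A i3 (cD2 A phi s) x by [].
have e2 : cD2 A phi (cD1 A phi s) x = D A i4 (cD1 A phi s) x
  - 'i%C *: lie (phi i1 x) (D A i2 s x + 'i%C *: D A i3 s x) by [].
rewrite e1 e2 (D_cD1 i4 ss Hx) (D_cD2 i2 ss Hx) (D_cD2 i3 ss Hx).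
exact: bracket12 (D_comm sA i2 i4 ss Hx) (D_comm sA i3 i4 ss Hx).
Qed.

Lemma calYE x : halfspace R x -> calY A phi x =
  (D A i4 (phi i2) x - lie (phi i1 x) (phi i3 x))
  + 'i%C *: - (D A i4 (phi i3) x + lie (phi i1 x) (phi i2 x)).
Proof.
move=> Hx; apply: opcommE => //.
  apply: sl2_complex; first by apply: su2B; [exact: su2_D|exact: su2_bracket].
  by apply: su2N; apply: su2D; [exact: su2_D|exact: su2_bracket].
move=> s ss _.
have e1 : cD2 A phi (cD3 A phi s) x = D A i4 (cD3 A phi s) x
  - 'i%C *: lie (phi i1 x) (lie (phi i2 x - 'i%C *: phi i3 x) (s x)) by [].
have e2 : cD3 A phi (cD2 A phi s) x = lie (phi i2 x - 'i%C *: phi i3 x)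
  (D A i4 s x - 'i%C *: lie (phi i1 x) (s x)) by [].
rewrite e1 e2 (D_cD3 i4 ss Hx); exact: bracket23.
Qed.

Lemma calZE x : halfspace R x -> calZ A phi x =
  - (D A i2 (phi i2) x + D A i3 (phi i3) x)
  + 'i%C *: (D A i2 (phi i3) x - D A i3 (phi i2) x).
Proof.
move=> Hx; apply: opcommE => //.
  by apply: sl2_complex; [apply: su2N; apply: su2D|apply: su2B]; exact: su2_D.
move=> s ss _.
have e1 : cD3 A phi (cD1 A phi s) x = lie (phi i2 x - 'i%C *: phi i3 x)
  (D A i2 s x + 'i%C *: D A i3 s x) by [].
have e2 : cD1 A phi (cD3 A phi s) x =
  D A i2 (cD3 A phi s) x + 'i%C *: D A i3 (cD3 A phi s) x by [].
rewrite e1 e2 (D_cD3 i2 ss Hx) (D_cD3 i3 ss Hx); exact: bracket31.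
Qed.

End OperatorCommutators.

(** * The quadratic identity *)

Section EnergyIdentity.
Local Open Scope ring_scope.
Variable R : realType.

Lemma big_ord4 (V : nmodType) (f : 'I_4 -> V) :
  \sum_(i < 4) f i = f i1 + f i2 + f i3 + f i4.
Proof.
rewrite !big_ord_recl big_ord0 addr0 !addrA.
by congr (_ + _ + _ + _); congr f; apply/val_inj.
Qed.

Notation sq P := (tr2 P P).

Lemma tr_antisym_square (W : 'I_4 -> 'I_4 -> 'M[R[i]]_2) :
  (forall i j, W j i = - W i j) -> (forall i, W i i = 0) ->
  \tr (2^-1 *: (\sum_(i < 4) \sum_(j < 4) W i j *m W i j)) =
  sq (W i1 i2) + sq (W i1 i3) + sq (W i1 i4)
  + sq (W i2 i3) + sq (W i2 i4) + sq (W i3 i4).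
Proof.
move=> W_as W_diag.
have sqN i j : sq (W j i) = sq (W i j).
  by rewrite W_as /tr2 mulmxN mulNmx opprK.
have sq0 i : sq (W i i) = 0 by rewrite W_diag /tr2 mul0mx linear0.
have -> : \tr (2^-1 *: (\sum_(i < 4) \sum_(j < 4) W i j *m W i j)) =
    2^-1 * \sum_(i < 4) \sum_(j < 4) sq (W i j).
  rewrite linearZ /= linear_sum; congr (_ * _).
  by apply: eq_bigr => i _; rewrite linear_sum.
rewrite !big_ord4 !sq0 (sqN i1 i2) (sqN i1 i3) (sqN i1 i4).
rewrite (sqN i2 i3) (sqN i2 i4) (sqN i3 i4).
generalize (sq (W i1 i2)) (sq (W i1 i3)) (sq (W i1 i4)).
generalize (sq (W i2 i3)) (sq (W i2 i4)) (sq (W i3 i4)) => a b c d e f.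
by field.
Qed.

(* F_ij, L_ij and G_ij stand for the curvature, [phi_i, phi_j] and D_i phi_j at
    one point. *)
Variables F L G : 'I_4 -> 'I_4 -> 'M[R[i]]_2.
Hypotheses (F_as : forall i j, F j i = - F i j) (F_diag : forall i, F i i = 0).
Hypotheses (L_as : forall i j, L j i = - L i j) (L_diag : forall i, L i i = 0).

Let V i j := F i j - L i j
  + \sum_(k < 4) \sum_(l < 4) G k l *~ levi_civita i j k l.

Let levi_swap i j k l : levi_civita j i k l = - levi_civita i j k l.
Proof.
rewrite /levi_civita -(opprB (i : nat)%:Z (j : nat)%:Z) sgrN.
ring.
Qed.

Let V_as i j : V j i = - V i j.
Proof.
rewrite /V (F_as i j) (L_as i j) !opprD -sumrN; congr (_ + _).
apply: eq_bigr => k _; rewrite -sumrN; apply: eq_bigr => l _.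
by rewrite levi_swap mulrNz.
Qed.

Let V_diag i : V i i = 0.
Proof.
rewrite /V F_diag L_diag subrr add0r big1// => k _; rewrite big1// => l _.
by rewrite /levi_civita subrr sgr0 !mul0r mulr0z.
Qed.

Ltac levi_compute :=
  rewrite /V !big_ord4;
  repeat match goal with |- context [levi_civita ?a ?b ?c ?d] =>
    let v := eval vm_compute in (levi_civita a b c d) in
    change (levi_civita a b c d) with v end;
  rewrite ?mulr0z ?mulr1z ?mulrN1z ?addr0 ?add0r.

Let V12 : V i1 i2 = F i1 i2 - L i1 i2 + (G i3 i4 - G i4 i3).
Proof. by levi_compute. Qed.

Let V13 : V i1 i3 = F i1 i3 - L i1 i3 + (- G i2 i4 + G i4 i2).
Proof. by levi_compute. Qed.

Let V14 : V i1 i4 = F i1 i4 - L i1 i4 + (G i2 i3 - G i3 i2).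
Proof. by levi_compute. Qed.

Let V23 : V i2 i3 = F i2 i3 - L i2 i3 + (G i1 i4 - G i4 i1).
Proof. by levi_compute. Qed.

Let V24 : V i2 i4 = F i2 i4 - L i2 i4 + (- G i1 i3 + G i3 i1).
Proof. by levi_compute. Qed.

Let V34 : V i3 i4 = F i3 i4 - L i3 i4 + (G i1 i2 - G i2 i1).
Proof. by levi_compute. Qed.

Let tr2E (P Q : 'M[R[i]]_2) : tr2 P Q =
  P ord0 ord0 * Q ord0 ord0 + P ord0 ord_max * Q ord_max ord0
  + (P ord_max ord0 * Q ord0 ord_max + P ord_max ord_max * Q ord_max ord_max).
Proof. by rewrite /tr2 mxtrace2E !mulmx2E. Qed.

(** For i < j the family V adds to F_ij - L_ij, up to sign, the difference
    G_kl - G_lk for the complementary pair.  Both sides are quadratic in the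
    entries of F, L and G, so once F and L are written through their components
    with i < j the identity is a comparison of coefficients. *)
Lemma energy_identity :
  \tr (2^-1 *: (\sum_(i < 4) \sum_(j < 4) V i j *m V i j)
       + (\sum_(i < 4) G i i) *m (\sum_(i < 4) G i i)) =
  sq (F i2 i4 + G i3 i1) + sq (F i3 i4 - G i2 i1)
  + (sq (G i4 i2 - L i1 i3) + sq (- (G i4 i3 + L i1 i2)))
  + (sq (- (G i2 i2 + G i3 i3)) + sq (G i2 i3 - G i3 i2))
  + sq (F i2 i3 - L i2 i3 - G i4 i1)
  + \sum_(a < 4) (sq (F i1 a) + sq (G i1 a) + sq (L a i4))
  + \sum_(b <- [:: i2; i3; i4]) sq (G b i4)
  + 2 * ((\sum_(a <- [:: i1; i2; i3])
            (tr2 (G a a) (G i4 i4) - tr2 (G i4 a) (G a i4) + tr2 (F a i4) (L i4 a))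
          + \sum_(a <- [:: i2; i3])
            (tr2 (G i1 i1) (G a a) - tr2 (G a i1) (G i1 a) + tr2 (F i1 a) (L a i1)))
   + (- (tr2 (G i1 i2) (L i3 i4) + tr2 (G i1 i3) (L i4 i2) + tr2 (G i1 i4) (L i2 i3))
      + (tr2 (G i2 i3) (L i4 i1) + tr2 (G i2 i4) (L i1 i3) + tr2 (G i2 i1) (L i3 i4))
      - (tr2 (G i3 i4) (L i1 i2) + tr2 (G i3 i1) (L i2 i4) + tr2 (G i3 i2) (L i4 i1)))
   + (tr2 (G i1 i2) (F i3 i4) + tr2 (G i1 i3) (F i4 i2) + tr2 (G i1 i4) (F i2 i3)
      + (- tr2 (G i2 i3) (F i4 i1) - tr2 (G i2 i4) (F i1 i3))
      + (tr2 (G i3 i2) (F i4 i1) + tr2 (G i3 i4) (F i1 i2))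
      + (- tr2 (G i4 i3) (F i1 i2) + tr2 (G i4 i2) (F i1 i3)))).
Proof.
rewrite linearD /= (tr_antisym_square V_as V_diag) V12 V13 V14 V23 V24 V34.
rewrite -/(tr2 _ _) !big_ord4.
rewrite !big_cons !big_nil F_diag L_diag.
rewrite (F_as i2 i4) (F_as i1 i4) (L_as i1 i2) (L_as i1 i3) (L_as i1 i4).
rewrite (L_as i2 i4) (L_as i3 i4) !tr2E !mxE.
ring.
Qed.

End EnergyIdentity.

(** * The densities as quadratic forms *)

Section Densities.
Local Open Scope ring_scope.
Variable R : realType.
Variables A phi : 'I_4 -> 'rV[R]_4 -> 'M[R[i]]_2.
Hypothesis hA : su2_form A.
Hypothesis hphi : su2_form phi.

Let sA i : smooth_field (A i). Proof. exact: (hA i).1. Qed.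
Let sphi i : smooth_field (phi i). Proof. exact: (hphi i).1. Qed.

Notation sq P := (tr2 P P).

Lemma I_densityE x : halfspace R x -> I_density A phi x =
  sq (F A i2 i4 x + D A i3 (phi i1) x) + sq (F A i3 i4 x - D A i2 (phi i1) x)
  + (sq (D A i4 (phi i2) x - lie (phi i1 x) (phi i3 x))
     + sq (- (D A i4 (phi i3) x + lie (phi i1 x) (phi i2 x))))
  + (sq (- (D A i2 (phi i2) x + D A i3 (phi i3) x))
     + sq (D A i2 (phi i3) x - D A i3 (phi i2) x))
  + sq (F A i2 i3 x - lie (phi i2 x) (phi i3 x) - D A i4 (phi i1) x)
  + \sum_(a < 4) (sq (F A i1 a x) + sq (D A i1 (phi a) x)
                  + sq (lie (phi a x) (phi i4 x)))
  + \sum_(b <- [:: i2; i3; i4]) sq (D A b (phi i4) x).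
Proof.
move=> Hx; rewrite /I_density calXE// calYE// calZE//.
have sF i j := su2_F hA i j Hx; have sD i j := su2_D hA hphi i j Hx.
have sL i j := su2_bracket hphi i j Hx.
rewrite 5!linearD /=; congr (_ + _ + _ + _ + _ + _).
- by apply: tr_conj_su; [apply: su2D|apply: su2B].
- by apply: tr_conj_su; [apply: su2B|apply: su2N; apply: su2D].
- by apply: tr_conj_su; [apply: su2N; apply: su2D|apply: su2B].
- by rewrite linear_sum; apply: eq_bigr => a _; rewrite linearD (linearD _ (_ *m _)).
- by rewrite linear_sum.
Qed.

(** By the Leibniz rule the second derivatives of t enter through
    D_a D_b t - D_b D_a t, which is the bracket of t with the curvature. *)
Lemma divergence_pair a b s t x : smooth_field s -> smooth_field t ->
  halfspace R x ->
  partialC a (fun y => tr2 (s y) (D A b t y)) x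
  - partialC b (fun y => tr2 (s y) (D A a t y)) x =
  tr2 (D A a s x) (D A b t x) - tr2 (D A b s x) (D A a t x)
  + tr2 (F A a b x) (lie (t x) (s x)).
Proof.
move=> ss st Hx.
rewrite (partialC_tr2 A a ss (smooth_field_D sA b st) Hx).
rewrite (partialC_tr2 A b ss (smooth_field_D sA a st) Hx).
have E : tr2 (F A a b x) (lie (t x) (s x)) =
    tr2 (s x) (D A a (D A b t) x) - tr2 (s x) (D A b (D A a t) x).
  apply: (etrans (tr2_lie _ _ _)); apply: (etrans (tr2C _ _)).
  apply: etrans (congr1 (tr2 (s x)) (esym (D_comm sA a b st Hx))) _.
  by rewrite tr2Dr tr2Nr.
by apply: etrans (subrACA _ _ _ _) _; congr (_ + _); exact: esym E.
Qed.

(** The Leibniz rule for the bracket, with each of the three terms rotated so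
    that the differentiated field stands first. *)
Lemma divergence_triple a s t r x : smooth_field s -> smooth_field t ->
  smooth_field r -> halfspace R x ->
  partialC a (fun y => tr2 (s y) (lie (t y) (r y))) x =
  tr2 (D A a s x) (lie (t x) (r x)) + tr2 (D A a t x) (lie (r x) (s x))
  + tr2 (D A a r x) (lie (s x) (t x)).
Proof.
move=> ss st sr Hx.
rewrite (partialC_tr2 A a ss (smooth_field_lie st sr) Hx) (D_lie A a st sr Hx).
rewrite tr2Dr addrA; congr (_ + _ + _); first exact: tr2_cycle.
exact: etrans (tr2_cycle _ _ _) (tr2_cycle _ _ _).
Qed.

Lemma Omega1_densityE x : halfspace R x -> Omega1_density A phi x =
  \sum_(a <- [:: i1; i2; i3])
    (tr2 (D A a (phi a) x) (D A i4 (phi i4) x)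
     - tr2 (D A i4 (phi a) x) (D A a (phi i4) x)
     + tr2 (F A a i4 x) (lie (phi i4 x) (phi a x)))
  + \sum_(a <- [:: i2; i3])
    (tr2 (D A i1 (phi i1) x) (D A a (phi a) x)
     - tr2 (D A a (phi i1) x) (D A i1 (phi a) x)
     + tr2 (F A i1 a x) (lie (phi a x) (phi i1 x))).
Proof.
move=> Hx; rewrite /Omega1_density; congr (_ + _).
  by apply: eq_bigr => a _; exact: divergence_pair.
by apply: eq_bigr => a _; exact: divergence_pair.
Qed.

Lemma Omega2_densityE x : halfspace R x -> Omega2_density phi x =
  - (tr2 (D A i1 (phi i2) x) (lie (phi i3 x) (phi i4 x))
     + tr2 (D A i1 (phi i3) x) (lie (phi i4 x) (phi i2 x))
     + tr2 (D A i1 (phi i4) x) (lie (phi i2 x) (phi i3 x)))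
  + (tr2 (D A i2 (phi i3) x) (lie (phi i4 x) (phi i1 x))
     + tr2 (D A i2 (phi i4) x) (lie (phi i1 x) (phi i3 x))
     + tr2 (D A i2 (phi i1) x) (lie (phi i3 x) (phi i4 x)))
  - (tr2 (D A i3 (phi i4) x) (lie (phi i1 x) (phi i2 x))
     + tr2 (D A i3 (phi i1) x) (lie (phi i2 x) (phi i4 x))
     + tr2 (D A i3 (phi i2) x) (lie (phi i4 x) (phi i1 x))).
Proof.
by move=> Hx; congr (- _ + _ - _); exact: divergence_triple.
Qed.

(** The Leibniz rule also produces Tr (phi_k D_a F_bc).  For k = 2, 3, 4 these terms
    add up to the pairing of phi_k with the Bianchi identity for the indices
    (1, 3, 4), (1, 4, 2) and (1, 2, 3), so only the terms with derivatives of phi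
    remain. *)
Lemma Omega3_densityE x : halfspace R x -> Omega3_density A phi x =
  tr2 (D A i1 (phi i2) x) (F A i3 i4 x) + tr2 (D A i1 (phi i3) x) (F A i4 i2 x)
  + tr2 (D A i1 (phi i4) x) (F A i2 i3 x)
  + (- tr2 (D A i2 (phi i3) x) (F A i4 i1 x)
     - tr2 (D A i2 (phi i4) x) (F A i1 i3 x))
  + (tr2 (D A i3 (phi i2) x) (F A i4 i1 x)
     + tr2 (D A i3 (phi i4) x) (F A i1 i2 x))
  + (- tr2 (D A i4 (phi i3) x) (F A i1 i2 x)
     + tr2 (D A i4 (phi i2) x) (F A i1 i3 x)).
Proof.
move=> Hx; rewrite /Omega3_density.
have sP k a b := smooth_field_mulmx (sphi k) (smooth_field_F sA a b).
have sN k a b := smooth_field_opp (sP k a b).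
pose q c k a b := tr2 (D A c (phi k) x) (F A a b x)
  + tr2 (phi k x) (D A c (F A a b) x).
have T c k a b : partialC c (fun y => \tr (phi k y *m F A a b y)) x = q c k a b.
  exact (partialC_tr2 A c (sphi k) (smooth_field_F sA a b) Hx).
have TN c k a b :
    partialC c (fun y => \tr (- (phi k y *m F A a b y))) x = - q c k a b.
  exact: etrans (partialC_trN c (sP k a b) Hx) (congr1 -%R (T c k a b)).
have e1 : partialC i1 (fun y => \tr (phi i2 y *m F A i3 i4 y
    + phi i3 y *m F A i4 i2 y + phi i4 y *m F A i2 i3 y)) x =
    q i1 i2 i3 i4 + q i1 i3 i4 i2 + q i1 i4 i2 i3.
  apply: etrans (partialC_trD i1
    (smooth_field_add (sP i2 i3 i4) (sP i3 i4 i2)) (sP i4 i2 i3) Hx) _.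
  apply: (congr2 +%R _ (T _ _ _ _)).
  exact: etrans (partialC_trD i1 (sP i2 i3 i4) (sP i3 i4 i2) Hx)
    (congr2 +%R (T _ _ _ _) (T _ _ _ _)).
have e2 : partialC i2 (fun y => \tr (- (phi i3 y *m F A i4 i1 y)
    - phi i4 y *m F A i1 i3 y)) x = - q i2 i3 i4 i1 - q i2 i4 i1 i3.
  exact: etrans (partialC_trD i2 (sN i3 i4 i1) (sN i4 i1 i3) Hx)
    (congr2 +%R (TN _ _ _ _) (TN _ _ _ _)).
have e3 : partialC i3 (fun y => \tr (phi i2 y *m F A i4 i1 y
    + phi i4 y *m F A i1 i2 y)) x = q i3 i2 i4 i1 + q i3 i4 i1 i2.
  exact: etrans (partialC_trD i3 (sP i2 i4 i1) (sP i4 i1 i2) Hx)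
    (congr2 +%R (T _ _ _ _) (T _ _ _ _)).
have e4 : partialC i4 (fun y => \tr (- (phi i3 y *m F A i1 i2 y)
    + phi i2 y *m F A i1 i3 y)) x = - q i4 i3 i1 i2 + q i4 i2 i1 i3.
  exact: etrans (partialC_trD i4 (sN i3 i1 i2) (sP i2 i1 i3) Hx)
    (congr2 +%R (TN _ _ _ _) (T _ _ _ _)).
rewrite e1 e2 e3 e4 /q.
have B2 := tr2_eq0 (phi i2 x) (bianchi sA i1 i3 i4 Hx).
have B3 := tr2_eq0NN (phi i3 x) (etrans (congr2 +%R (congr2 +%R erefl
  (esym (D_F_antisym sA i4 i1 i2 Hx))) (esym (D_F_antisym sA i2 i4 i1 Hx)))
  (bianchi sA i1 i4 i2 Hx)).
have B4 := tr2_eq0N (phi i4 x) (etrans (congr2 +%R (congr2 +%R erefl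
  (esym (D_F_antisym sA i2 i1 i3 Hx))) erefl) (bianchi sA i1 i2 i3 Hx)).
move: B2 B3 B4.
repeat match goal with |- context [tr2 ?P ?Q] => generalize (tr2 P Q); intro end.
(* The difference of the two sides is the sum of the three Bianchi relations. *)
move=> B2 B3 B4; apply/eqP; rewrite -subr_eq0; apply/eqP.
apply: etrans (_ : _ = 0 + 0 + 0) _; last by rewrite !addr0.
rewrite -{1}B2 -{1}B3 -B4; ring.
Qed.

Lemma KW_densityE x : halfspace R x -> KW_density A phi x =
  I_density A phi x + 2 * (Omega1_density A phi x + Omega2_density phi x
                           + Omega3_density A phi x).
Proof.
move=> Hx; rewrite (I_densityE Hx) (Omega1_densityE Hx) (Omega2_densityE Hx).
rewrite (Omega3_densityE Hx).
apply: (@energy_identity R (fun i j => F A i j x)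
  (fun i j => lie (phi i x) (phi j x)) (fun i j => D A i (phi j) x)) => *.
- exact: F_antisym.
- by rewrite /F liexx subrr addr0.
- exact: lieC.
- exact: liexx.
Qed.

End Densities.

(** * Integration *)

Section Integrals.
Local Open Scope classical_set_scope.
Local Open Scope ring_scope.
Variable R : realType.
Implicit Types f g : 'rV[R]_4 -> R[i].

(** Measurability for the sigma-algebra on which mu is defined; stating it
    through mu avoids choosing between the presentations of the Borel sets of
    R. *)
Definition measured_by d (T : measurableType d) (mu : set T -> \bar R)
  (X : set T) : Prop := measurable X.

Lemma measurable_halfspace : measured_by (leb4 R) (@pt R @^-1` halfspace R).
Proof.
rewrite /measured_by.
have -> : @pt R @^-1` halfspace R = setT `&` snd @^-1` [set` `[0, +oo[%R].
  apply/seteqP; split=> p; rewrite /halfspace /= mxE (tnth_nth 0) /= in_itv /= andbT //.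
  by case.
apply: measurable_snd => //.
Qed.

Lemma int4_ext f g : (forall x, halfspace R x -> f x = g x) -> int4 f = int4 g.
Proof.
move=> fg; congr (_ +i* _)%C; apply: eq_Rintegral => p /set_mem Hp; by rewrite fg.
Qed.

Lemma converges_add f g : converges f -> converges g ->
  converges (fun x => f x + g x).
Proof.
move=> [fr fi] [gr gi]; split.
  rewrite [X in _.-integrable _ X](_ : _ = (fun p =>
    (complex.Re (f (pt p)))%:E + (complex.Re (g (pt p)))%:E)%E).
    exact: (integrableD measurable_halfspace fr gr).
  by apply/funext => p; rewrite ReD.
rewrite [X in _.-integrable _ X](_ : _ = (fun p =>
  (complex.Im (f (pt p)))%:E + (complex.Im (g (pt p)))%:E)%E).
  exact: (integrableD measurable_halfspace fi gi).
by apply/funext => p; rewrite ImD.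
Qed.

Lemma int4_add f g : converges f -> converges g ->
  int4 (fun x => f x + g x) = int4 f + int4 g.
Proof.
move=> [fr fi] [gr gi]; have mH := measurable_halfspace.
apply: complexP; rewrite ?ReD ?ImD /=.
  rewrite -(RintegralD mH fr gr).
  by apply: eq_Rintegral => p _; rewrite ReD.
rewrite -(RintegralD mH fi gi).
by apply: eq_Rintegral => p _; rewrite ImD.
Qed.

End Integrals.

Theorem mainTheorem4 (R : realType)
    (A phi : 'I_4 -> 'rV[R]_4 -> 'M[R[i]]_2)
    (hA : su2_form A) (hphi : su2_form phi)
    (cV : converges (KW_density A phi))
    (cI : converges (I_density A phi))
    (c1 : converges (Omega1_density A phi))
    (c2 : converges (Omega2_density phi))
    (c3 : converges (Omega3_density A phi)) :
  - int4 (KW_density A phi) =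
    Ipp A phi + Omega1 A phi + Omega2 phi + Omega3 A phi.
Proof.
have c12 := converges_add c1 c2; have c123 := converges_add c12 c3.
have c0 := converges_add c123 c123.
have E : int4 (KW_density A phi) =
    int4 (I_density A phi) + (int4 (Omega1_density A phi)
      + int4 (Omega2_density phi) + int4 (Omega3_density A phi)) *+ 2.
  rewrite -(int4_add c1 c2) -(int4_add c12 c3) mulr2n -(int4_add c123 c123).
  rewrite -(int4_add cI c0); apply: int4_ext => x Hx.
  by rewrite (KW_densityE hA hphi Hx) mulr_natl mulr2n.
rewrite E /Ipp /Omega1 /Omega2 /Omega3; ring.
Qed.
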